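(* Let $f(\cdot,\xi)$ be $(\mathcal L_0,\mathcal L_1)$-smooth and convex for almost every $\xi\sim\mathcal D$, and let the stochastic gradient oracle be unbiased and satisfy the strong growth condition with constant $\rho\ge1$, i.e. $\mathbb{E}_\xi[\|\nabla f(x,\xi)\|^2]\le\rho\|\nabla f(x)\|^2$ for all $x\in\mathbb{R}^d$. Then ClipSGD with clipping radius $c>0$, constant step size $0<\eta\le[9(\mathcal L_0+\sqrt\rho\,\mathcal L_1c)]^{-1}$ and batch size $B\ge36(\rho-1)$ yields, after $N$ iterations, $$\mathbb{E}[f(x^N)]-f^*\le\max\left\{\left(1-\frac{\eta c}{36R_0}\right)^{N/2}F_0,\ \frac{18R_0^2}{N\eta}\right\},$$ where $F_0=f(x^0)-f^*$ and $R_0=\|x^0-x^*\|$.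
   Context: Setting: $f(x)=\mathbb{E}_{\xi\sim\mathcal D}[f(x,\xi)]$ on $\mathbb{R}^d$, with $f$ and $f(\cdot,\xi)$ differentiable, $f^*=\min_{x}f(x)$, $x^*\in\arg\min f$, and $\|\cdot\|$ the Euclidean norm. The oracle returns stochastic gradients $\nabla f(x,\xi)$, $\xi\sim\mathcal D$. ''$f(\cdot,\xi)$ is $(\mathcal L_0,\mathcal L_1)$-smooth and convex'' ($\mathcal L_0,\mathcal L_1\ge0$) means: for all $x,y,z\in\mathbb{R}^d$ with $\|y-z\|\le1/\mathcal L_1$ (with $1/\mathcal L_1=+\infty$ if $\mathcal L_1=0$), $$f(x,\xi)+\langle\nabla f(x,\xi),y-x\rangle\le f(y,\xi)\le f(z,\xi)+\langle\nabla f(z,\xi),y-z\rangle+\frac{\mathcal L_0+\mathcal L_1\|\nabla f(z,\xi)\|}{2}\|y-z\|^2.$$ Unbiasedness: $\mathbb{E}_\xi[\nabla f(x,\xi)]=\nabla f(x)$ for all $x$. ClipSGD: given $x^0\in\mathbb{R}^d$, integer batch size $B\ge1$, $\eta>0$, $c>0$; at iteration $k$ draw fresh i.i.d. samples $\xi_1^k,\dots,\xi_B^k\sim\mathcal D$ (independent of the past), form $g^k=\frac1B\sum_{i=1}^B\nabla f(x^k,\xi_i^k)$, and set $x^{k+1}=x^k-\eta\,\min\{1,c/\|g^k\|\}\,g^k$ (the factor is $1$ if $g^k=0$). *)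

(* Defs.v *)
From HB Require Import structures.
From mathcomp Require Import all_boot all_order all_algebra.
From mathcomp Require Import finmap.
From mathcomp Require Import all_classical all_reals all_analysis.

Set Implicit Arguments.
Unset Strict Implicit.
Unset Printing Implicit Defensive.

Import Order.TTheory GRing.Theory Num.Theory.
Import numFieldNormedType.Exports.

Local Open Scope classical_set_scope.
Local Open Scope ring_scope.

Definition dotp (R : realType) (d : nat) (u v : 'rV[R]_d) : R :=
  \sum_(i < d) u 0 i * v 0 i.

(* The library norm `|u| on 'rV[R]_d is the sup norm, hence this definition. *)
Definition enorm (R : realType) (d : nat) (u : 'rV[R]_d) : R :=
  Num.sqrt (dotp u u).

Definition grad (R : realType) (d : nat) (h : 'rV[R]_d -> R) (x : 'rV[R]_d) :
    'rV[R]_d :=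
  \row_(i < d) 'D_(delta_mx 0 i) h x.

(* The condition L1 * enorm (y - z) <= 1 is enorm (y - z) <= 1 / L1 with the
   convention 1 / 0 = +oo. *)
Definition L0L1_smooth_convex (R : realType) (d : nat) (L0 L1 : R)
    (h : 'rV[R]_d -> R) : Prop :=
  forall x y z : 'rV[R]_d, L1 * enorm (y - z) <= 1 ->
    h x + dotp (grad h x) (y - x) <= h y /\
    h y <= h z + dotp (grad h z) (y - z)
           + (L0 + L1 * enorm (grad h z)) / 2 * enorm (y - z) ^+ 2.

(* Meaningful when F x is D-integrable. *)
Definition objective (R : realType) (d : nat) (dX : measure_display)
    (X : measurableType dX) (D : probability X R) (F : 'rV[R]_d -> X -> R)
    (x : 'rV[R]_d) : R :=
  fine ('E_D[F x])%E.

Definition stoch_grad (R : realType) (d : nat) (X : Type)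
    (F : 'rV[R]_d -> X -> R) (x : 'rV[R]_d) (s : X) : 'rV[R]_d :=
  grad (F ^~ s) x.

Definition unbiased (R : realType) (d : nat) (dX : measure_display)
    (X : measurableType dX) (D : probability X R)
    (F : 'rV[R]_d -> X -> R) : Prop :=
  forall (x : 'rV[R]_d) (i : 'I_d),
    D.-integrable [set: X] (fun s => (stoch_grad F x s 0 i)%:E) /\
    ('E_D[fun s => (stoch_grad F x s 0 i)%R]
       = (grad (objective D F) x 0 i)%R%:E)%E.

Definition strong_growth (R : realType) (d : nat) (dX : measure_display)
    (X : measurableType dX) (D : probability X R)
    (F : 'rV[R]_d -> X -> R) (rho : R) : Prop :=
  forall x : 'rV[R]_d,
    ('E_D[fun s => (enorm (stoch_grad F x s) ^+ 2)%R]
       <= (rho * enorm (grad (objective D F) x) ^+ 2)%R%:E)%E.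

Definition mutually_independent (R : realType) (dO dX : measure_display)
    (Omega : measurableType dO) (X : measurableType dX)
    (P : probability Omega R) (I : choiceType) (Y : I -> {RV P >-> X}) : Prop :=
  forall (J : {fset I}) (A : I -> set X),
    (forall i, i \in J -> measurable (A i)) ->
    P (\bigcap_(i in [set` J]) (Y i @^-1` A i)) =
    (\prod_(i <- J) P (Y i @^-1` A i))%E.

Definition iid_samples (R : realType) (dO dX : measure_display)
    (Omega : measurableType dO) (X : measurableType dX)
    (P : probability Omega R) (D : probability X R) (B : nat)
    (xi : nat -> 'I_B -> {RV P >-> X}) : Prop :=
  (forall k i (A : set X), measurable A -> distribution P (xi k i) A = D A) /\
  mutually_independent (fun ki : nat * 'I_B => xi ki.1 ki.2).

Definition minibatch_grad (R : realType) (d : nat) (X : Type)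
    (F : 'rV[R]_d -> X -> R) (B : nat) (s : 'I_B -> X) (x : 'rV[R]_d) :
    'rV[R]_d :=
  B%:R^-1 *: \sum_(i < B) stoch_grad F x (s i).

Definition clip_factor (R : realType) (d : nat) (c : R) (g : 'rV[R]_d) : R :=
  if g == 0 then 1 else Num.min 1 (c / enorm g).

(* The iterate x^k along one realization s of the samples. *)
Fixpoint clipSGD (R : realType) (d : nat) (X : Type)
    (F : 'rV[R]_d -> X -> R) (B : nat) (eta c : R) (x0 : 'rV[R]_d)
    (s : nat -> 'I_B -> X) (k : nat) : 'rV[R]_d :=
  if k is k'.+1 then
    let x := clipSGD F eta c x0 s k' in
    let g := minibatch_grad F (s k') x in
    x - (eta * clip_factor c g) *: g
  else x0.

(* Main.v *)
Require Import Defs.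
From HB Require Import structures.
From mathcomp Require Import all_boot all_order all_algebra.
From mathcomp Require Import finmap zify ring lra.
From mathcomp Require Import all_classical all_reals all_analysis measurable_realfun.

Set Implicit Arguments.
Unset Strict Implicit.
Unset Printing Implicit Defensive.

Import Order.TTheory GRing.Theory Num.Theory.
Import numFieldNormedType.Exports.

Local Open Scope classical_set_scope.
Local Open Scope ring_scope.

(** Write [G] for the norm of the exact gradient at the current iterate, [w] for
    the clipping factor [min 1 (c / G)] that this gradient would receive, and [e]
    for the error of the batch gradient.

    Strong growth forces interpolation: the exact gradient vanishes at the
    minimizer, hence so does almost every sampled gradient.  Almost every sampled
    function is therefore minimized at the same point, and a clipped step along
    an average of their gradients cannot increase the distance to that point
    ([clipped_step_nonexpansive]).  All iterates stay almost surely within [R0]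
    of the minimizer, and convexity bounds the optimality gap by [R0 * G].

    By Jensen's inequality the objective is smooth with constants [L0] and
    [sqrt rho * L1], and a deterministic estimate ([clipped_descent]) gives, on
    every realization, a decrease of the objective by at least
    [eta * w * (G ^ 2 / 2 - 7 * |e| ^ 2)].  The weight [w] depends on the past
    only, while the current batch is independent of the past with mutually
    independent samples, so that the mean of [w * |e| ^ 2] is at most
    [(rho - 1) / B <= 1 / 36] times the mean of [w * G ^ 2]
    ([mean_batch_error2_le]).  Hence the mean gap [D k] decreases at each step by
    at least [11 / 36 * eta] times the mean of [w * G ^ 2 = min c G * G].

    That function of [G] is not convex, but affine minorants of slope at most
    [c] survive averaging, and the mean of [G] is at least [D k / R0]; this
    yields the scalar recursion
    [D k.+1 <= D k - eta / 9 * min c (D k / R0) * (D k / R0)].  Once [D k] has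
    fallen below [c * R0] it remains there, so one of the two regimes covers half
    of the steps: the first is geometric, the second decreases like [1 / k]
    ([two_regime_rate]).

    The measure theory rests on two facts.  A function of a point and a sample
    that is continuous in the point and measurable in the sample is measurable
    along any measurable trajectory ([measurable_comp_caratheodory]), and so is
    its gradient.  The value of one sample can be integrated out while all the
    other samples are frozen ([freezing_off_le], [freezing_off_mean0]). *)

(** * Euclidean geometry of row vectors *)

Section Euclidean.
Variables (R : realType) (d : nat).
Implicit Types u v w : 'rV[R]_d.

Lemma dotpC u v : dotp u v = dotp v u.
Proof. by apply: eq_bigr => i _; rewrite mulrC. Qed.

Lemma dotpDr u v w : dotp u (v + w) = dotp u v + dotp u w.
Proof.
by rewrite /dotp -big_split; apply: eq_bigr => i _ /=; rewrite mxE mulrDr.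
Qed.

Lemma dotpZr (a : R) u v : dotp u (a *: v) = a * dotp u v.
Proof.
by rewrite /dotp mulr_sumr; apply: eq_bigr => i _; rewrite mxE mulrCA.
Qed.

Lemma dotpDl u v w : dotp (u + v) w = dotp u w + dotp v w.
Proof. by rewrite dotpC dotpDr !(dotpC w). Qed.

Lemma dotpZl (a : R) u v : dotp (a *: u) v = a * dotp u v.
Proof. by rewrite dotpC dotpZr dotpC. Qed.

Lemma dotpNr u v : dotp u (- v) = - dotp u v.
Proof. by rewrite -scaleN1r dotpZr mulN1r. Qed.

Lemma dotpBr u v w : dotp u (v - w) = dotp u v - dotp u w.
Proof. by rewrite dotpDr dotpNr. Qed.

Lemma dotpBl u v w : dotp (u - v) w = dotp u w - dotp v w.
Proof. by rewrite dotpC dotpBr !(dotpC w). Qed.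

Lemma dotp0r u : dotp u 0 = 0.
Proof. by rewrite -(scale0r 0) dotpZr mul0r. Qed.

Lemma dotp0l u : dotp 0 u = 0.
Proof. by rewrite dotpC dotp0r. Qed.

Lemma dotp_suml n (u : 'I_n -> 'rV[R]_d) v :
  dotp (\sum_(i < n) u i) v = \sum_(i < n) dotp (u i) v.
Proof.
by elim/big_ind2: _ => [|? ? ? ? <- <-|//]; rewrite ?dotp0l ?dotpDl.
Qed.

Lemma dotp_sumr n (u : 'I_n -> 'rV[R]_d) v :
  dotp v (\sum_(i < n) u i) = \sum_(i < n) dotp v (u i).
Proof. by rewrite dotpC dotp_suml; apply: eq_bigr => i _; rewrite dotpC. Qed.

Lemma dotp_ge0 u : 0 <= dotp u u.
Proof. by apply: sumr_ge0 => i _; rewrite -expr2 sqr_ge0. Qed.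

Lemma enorm_ge0 u : 0 <= enorm u.
Proof. exact: sqrtr_ge0. Qed.

Lemma enormE u : enorm u ^+ 2 = dotp u u.
Proof. by rewrite sqr_sqrtr ?dotp_ge0. Qed.

Lemma coord_le_enorm u i : `|u 0 i| <= enorm u.
Proof.
rewrite -(ler_pXn2r (_ : 0 < 2)%N) ?nnegrE ?enorm_ge0// enormE /dotp.
rewrite (bigD1 i)//= real_normK ?num_real// -expr2 lerDl.
by apply: sumr_ge0 => j _; rewrite -expr2 sqr_ge0.
Qed.

Lemma enorm0_eq0 u : enorm u = 0 -> u = 0.
Proof.
move=> u0; apply/rowP => i; rewrite mxE; apply/eqP.
by rewrite -normr_le0 -u0 coord_le_enorm.
Qed.

Lemma enorm0 : enorm (0 : 'rV[R]_d) = 0.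
Proof. by rewrite /enorm dotp0r sqrtr0. Qed.

Lemma enorm_eq0 u : (enorm u == 0) = (u == 0).
Proof. by apply/eqP/eqP => [/enorm0_eq0|->//]; rewrite ?enorm0. Qed.

Lemma enormZ (a : R) u : enorm (a *: u) = `|a| * enorm u.
Proof.
by rewrite /enorm dotpZr dotpZl mulrA -expr2 sqrtrM ?sqr_ge0// sqrtr_sqr.
Qed.

Lemma enormN u : enorm (- u) = enorm u.
Proof. by rewrite -scaleN1r enormZ normrN1 mul1r. Qed.

Lemma enormD2 u v :
  enorm (u + v) ^+ 2 = enorm u ^+ 2 + 2 * dotp u v + enorm v ^+ 2.
Proof. by rewrite !enormE dotpDl !dotpDr (dotpC v u); ring. Qed.

Lemma enormB2 u v :
  enorm (u - v) ^+ 2 = enorm u ^+ 2 - 2 * dotp u v + enorm v ^+ 2.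
Proof. by rewrite enormD2 dotpNr enormN; ring. Qed.

Lemma cauchy_schwarz u v : dotp u v <= enorm u * enorm v.
Proof.
have [/enorm0_eq0->|u0] := eqVneq (enorm u) 0; first by rewrite dotp0l enorm0 mul0r.
have [/enorm0_eq0->|v0] := eqVneq (enorm v) 0; first by rewrite dotp0r enorm0 mulr0.
have uv : 0 < enorm u * enorm v.
  by rewrite mulr_gt0// lt_neqAle eq_sym ?u0 ?v0 enorm_ge0.
rewrite -subr_ge0 -(pmulr_rge0 _ uv).
have := dotp_ge0 (enorm v *: u - enorm u *: v).
rewrite !(dotpBl, dotpBr) !(dotpZl, dotpZr) -!enormE (dotpC v u).
by move=> h; nra.
Qed.

Lemma normr_dotp_le u v : `|dotp u v| <= enorm u * enorm v.
Proof.
rewrite ler_norml cauchy_schwarz andbT lerNl -dotpNr.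
by rewrite -[leRHS](_ : enorm u * enorm (- v) = _) ?cauchy_schwarz ?enormN.
Qed.

Lemma enorm_triangle u v : enorm (u + v) <= enorm u + enorm v.
Proof.
rewrite -(ler_pXn2r (_ : 0 < 2)%N) ?nnegrE ?addr_ge0 ?enorm_ge0//.
by rewrite enormD2; have := cauchy_schwarz u v; nra.
Qed.

Lemma enorm_sum_le n (u : 'I_n -> 'rV[R]_d) :
  enorm (\sum_(i < n) u i) <= \sum_(i < n) enorm (u i).
Proof.
elim/big_ind2: _ => [|x a y b xa yb|//]; first by rewrite enorm0.
by rewrite (le_trans (enorm_triangle _ _))// lerD.
Qed.

(** The direction [u / |u|] serves all vectors at once: it is [0] when
    [u = 0], and the two properties below survive. *)
Lemma unit_direction u :
  exists2 v, enorm v <= 1 & dotp u v = enorm u.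
Proof.
exists ((enorm u)^-1 *: u).
  rewrite enormZ ger0_norm ?invr_ge0 ?enorm_ge0//.
  have [->|u0] := eqVneq (enorm u) 0; first by rewrite mulr0.
  by rewrite mulVf.
rewrite dotpZr -enormE.
have [->|u0] := eqVneq (enorm u) 0; first by rewrite expr0n mulr0.
by rewrite expr2 mulKf.
Qed.

End Euclidean.

(** * A scalar recursion with two regimes *)

Section Recursion.
Variable R : realType.

(** With [u = a * D k] the induction step is [(n + 1) * u * (1 - u) <= 1]
    whenever [n * u <= 1]. *)
Lemma quadratic_decrease_rate (a : R) (D : nat -> R) (m n : nat) :
  0 <= a -> (forall k, 0 <= D k) ->
  (forall k, (m <= k)%N -> D k.+1 <= D k - a * D k ^+ 2) ->
  n%:R * (a * D (m + n)%N) <= 1.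
Proof.
move=> a0 D0 rec; elim: n => [|n IH]; first by rewrite mul0r ler01.
have := rec (m + n)%N (leq_addr _ _); rewrite addnS.
set x := D (m + n)%N; set y := D _ => yx.
have u0 : 0 <= a * x by rewrite mulr_ge0 ?D0.
have ayx : a * y <= a * x - (a * x) ^+ 2 by nra.
move: IH; rewrite -/x -natr1 => IH.
have n0 : 0 <= n%:R :> R by rewrite ler0n.
have : (n%:R + 1) * (a * y) <= (n%:R + 1) * (a * x - (a * x) ^+ 2).
  by rewrite ler_wpM2l// addr_ge0.
move/le_trans; apply.
have [xn|xn] := leP ((n%:R + 1) * (a * x)) 1; first by nra.
by nra.
Qed.

Lemma geometric_decrease (b : R) (D : nat -> R) (n : nat) :
  0 <= b -> (forall k, (k < n)%N -> D k.+1 <= b * D k) ->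
  D n <= b ^+ n * D 0%N.
Proof.
move=> b0; elim: n => [|n IH] rec; first by rewrite mul1r.
rewrite (le_trans (rec _ _))// exprS -mulrA ler_wpM2l// IH// => k kn.
by apply: rec; rewrite ltnW.
Qed.

(** A nonincreasing sequence leaves the regime [c * r <= D k] once and for all.
    Either it stays there for the first half of the steps and decreases
    geometrically, or it spends the second half in the other regime, where it
    decreases like [1 / k]. *)
Lemma two_regime_rate (c r eta : R) (D : nat -> R) (N : nat) :
  0 < c -> 0 < r -> 0 < eta -> (forall k, 0 <= D k) ->
  (forall k, D k.+1 <= D k - eta / 9 * Num.min c (D k / r) * (D k / r)) ->
  D N <= Num.max ((Num.max 0 (1 - eta * c / (36 * r))) `^ (N%:R / 2) * D 0%N)
           (18 * r ^+ 2 / (N%:R * eta)).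
Proof.
move=> c0 r0 eta0 D0 rec; set b := Num.max 0 _.
case: N => [|n]; first by rewrite mul0r powRr0 mul1r le_max lexx.
have s0 k : 0 <= D k / r by rewrite divr_ge0// ltW.
have nincr j k : (j <= k)%N -> D k <= D j.
  move=> jk; rewrite -(subnKC jk); elim: (k - j)%N => [|i IH]; first by rewrite addn0.
  rewrite addnS (le_trans (rec _))// (le_trans _ IH)// gerBl.
  by rewrite mulr_ge0// mulr_ge0 ?divr_ge0 ?(ltW eta0)// le_min (ltW c0) s0.
have b0 : 0 <= b by rewrite le_max lexx.
have q0 : 0 < eta * c / (36 * r) by rewrite divr_gt0 ?mulr_gt0.
have b1 : b <= 1 by rewrite ge_max ler01/= gerBl ltW.
rewrite le_max; apply/orP.
(* The regime is read off at the last index of the first half, rounded up, so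
   that each half has at least [N / 2] steps. *)
have [big|small] := leP (c * r) (D (uphalf n.+1).-1); [left|right].
  have stay k : (k < uphalf n.+1)%N -> D k.+1 <= b * D k.
    move=> kM; have cD : c <= D k / r.
      by rewrite ler_pdivlMr// (le_trans big)// nincr// -ltnS prednK// (leq_ltn_trans _ kM).
    rewrite (le_trans (rec k))// (min_idPl cD).
    rewrite (_ : D k - _ = (1 - eta * c / (9 * r)) * D k); last by field; rewrite gt_eqF.
    rewrite ler_wpM2r// (@le_trans _ _ (1 - eta * c / (36 * r)))//; last first.
      by rewrite le_max lexx orbT.
    rewrite lerD2l lerN2 ler_pM2l ?mulr_gt0// lef_pV2 ?posrE ?mulr_gt0// ler_pM2r//.
    by rewrite ler_nat.
  apply: le_trans (nincr (uphalf n.+1) _ _) _; first by lia.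
  rewrite (le_trans (geometric_decrease b0 stay))// ler_wpM2r// -powR_mulrn//.
  have [->|bpos] := eqVneq b 0.
    by rewrite !powR0// ?mulf_neq0 ?invr_neq0 ?pnatr_eq0//.
  apply: ger_powR; first by rewrite lt_neqAle eq_sym bpos b0.
  rewrite ler_pdivrMr// -natrM ler_nat.
  by lia.
have a0 : 0 <= eta / (9 * r ^+ 2) by rewrite divr_ge0 ?mulr_ge0 ?sqr_ge0// ltW.
set m := (uphalf n.+1).-1 in small.
have leave k : (m <= k)%N -> D k.+1 <= D k - eta / (9 * r ^+ 2) * D k ^+ 2.
  move=> mk; have Dc : D k / r <= c.
    by rewrite ler_pdivrMr// (le_trans (nincr _ _ mk))// ltW.
  rewrite (le_trans (rec k))// (min_idPr Dc) le_eqVlt; apply/orP; left; apply/eqP.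
  by field; rewrite gt_eqF.
have mn : (m <= n.+1)%N by rewrite /m; lia.
have := quadratic_decrease_rate (n.+1 - m)%N a0 D0 leave.
rewrite subnKC// => rate.
have half : n.+1%:R <= 2 * (n.+1 - m)%:R :> R by rewrite -natrM ler_nat /m; lia.
rewrite ler_pdivlMr ?mulr_gt0//.
have e : 2 * (n.+1 - m)%:R * (eta * D n.+1)
       = ((n.+1 - m)%:R * (eta / (9 * r ^+ 2) * D n.+1)) * (18 * r ^+ 2).
  by field; rewrite gt_eqF.
have : 2 * (n.+1 - m)%:R * (eta * D n.+1) <= 18 * r ^+ 2.
  by rewrite e -[leRHS]mul1r ler_wpM2r// mulr_ge0 ?sqr_ge0.
apply: le_trans.
rewrite (_ : D n.+1 * _ = n.+1%:R * (eta * D n.+1)); last by ring.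
by rewrite ler_wpM2r// mulr_ge0 ?D0 ?(ltW eta0).
Qed.

End Recursion.

(** * One clipped step along one realization *)

Section ClippedStep.
Variables (R : realType) (d : nat).
Implicit Types u v g x y z : 'rV[R]_d.

Lemma clip_factorP (c : R) g : 0 < c ->
  (clip_factor c g = 1 /\ enorm g <= c) \/
  [/\ c < enorm g, 0 < clip_factor c g, clip_factor c g < 1
    & clip_factor c g * enorm g = c].
Proof.
move=> c0; rewrite /clip_factor; case: eqVneq => [->|g0].
  by left; rewrite enorm0 ltW.
have n0 : 0 < enorm g by rewrite lt_neqAle eq_sym enorm_eq0 g0 enorm_ge0.
have [gc|gc] := leP (enorm g) c; [left|right].
  by split=> //; apply/min_idPl; rewrite ler_pdivlMr// mul1r.
have lt1 : c / enorm g < 1 by rewrite ltr_pdivrMr// mul1r.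
by rewrite (min_idPr (ltW lt1)) divr_gt0// mulfVK// gt_eqF.
Qed.

Lemma clip_factor_ge0 (c : R) g : 0 < c -> 0 <= clip_factor c g.
Proof. by move=> /(clip_factorP g)[[-> _]|[_ /ltW]]. Qed.

Lemma clip_factor_le1 (c : R) g : 0 < c -> clip_factor c g <= 1.
Proof. by move=> /(clip_factorP g)[[-> _]|[_ _ /ltW]]. Qed.

Lemma clipped_norm_le (c : R) g : 0 < c -> clip_factor c g * enorm g <= c.
Proof. by move=> /(clip_factorP g)[[-> ?]|[_ _ _ ->]]; rewrite ?mul1r. Qed.

(** Clipping an estimate [g] of [v] keeps the correlation with [v], up to twice
    the error [|g - v|], as if [v] itself had been clipped. *)
Lemma clipped_correlation (c : R) v g : 0 < c ->
  clip_factor c v * (enorm v ^+ 2 - 2 * enorm v * enorm (g - v))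
    <= clip_factor c g * dotp v g.
Proof.
move=> c0; set e := g - v.
have gE : g = v + e by rewrite /e addrC subrK.
have vE : v = g - e by rewrite gE addrK.
have pv : enorm v ^+ 2 - enorm v * enorm e <= dotp v g.
  have := normr_dotp_le v e; rewrite gE dotpDr -enormE ler_norml => /andP[]; lra.
have pg : enorm g ^+ 2 - enorm g * enorm e <= dotp v g.
  rewrite {1}vE dotpBl -enormE (dotpC e).
  by have := normr_dotp_le g e; rewrite ler_norml => /andP[]; lra.
have pn : - (enorm v * enorm g) <= dotp v g.
  by have := normr_dotp_le v g; rewrite ler_norml => /andP[].
have ng : enorm v - enorm e <= enorm g.
  by rewrite lerBlDr {1}vE -(enormN e) enorm_triangle.
have := enorm_ge0 v; have := enorm_ge0 g; have := enorm_ge0 e.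
have := clip_factorP v c0; have := clip_factorP g c0.
move: (clip_factor c v) (clip_factor c g) (dotp v g) pv pg pn ng.
move: (enorm v) (enorm g) (enorm e) => G n eps w a p pv pg pn ng.
(* Four cases: whether [g], then [v], exceeds the threshold. *)
case=> [[-> nc]|[cn a0 a1 an]]; case=> [[-> Gc]|[cG w0 w1 wG]] eps0 n0 G0.
- by rewrite !mul1r (le_trans _ pv)// lerB// ler_wpM2r// ler_peMl// ler1n.
- rewrite mul1r (_ : w * _ = c * (G - 2 * eps)); last by rewrite -wG; ring.
  have [Ge|Ge] := leP eps G.
    by apply: le_trans pv; nra.
  by apply: le_trans pn; nra.
- rewrite mul1r; have [Ge|Ge] := leP (2 * eps) G.
    apply: (@le_trans _ _ (a * (n ^+ 2 - n * eps))); last by rewrite ler_pM2l.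
    rewrite (_ : a * _ = c * (n - eps)); last by rewrite -an; ring.
    by nra.
  apply: (@le_trans _ _ (a * (G ^+ 2 - G * eps))); last by rewrite ler_pM2l.
  have Geps : 0 <= G * eps by rewrite mulr_ge0.
  have [q0|q0] := leP 0 (G ^+ 2 - G * eps).
    have : 0 <= a * (G ^+ 2 - G * eps) by rewrite mulr_ge0// ltW.
    by apply: le_trans; nra.
  by nra.
- rewrite (_ : w * _ = c * (G - 2 * eps)); last by rewrite -wG; ring.
  apply: (@le_trans _ _ (a * (n ^+ 2 - n * eps))); last by rewrite ler_pM2l.
  rewrite (_ : a * (_ - _) = c * (n - eps)); last by rewrite -an; ring.
  by rewrite ler_pM2l//; lra.
Qed.

(** The quadratic term is harmless at both scales: below the threshold the
    step condition bounds [L0 + L * |v|] and the step is at most [eta * |g|], beyond it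
    the curvature grows like [|v| / c] while the step is at most [eta * c].  The
    cross term [|v| * |g - v|] is split so that only the square of the error
    remains, the quantity whose mean is controlled by the batch size. *)
Lemma clipped_descent (L0 L c eta : R) (f : 'rV[R]_d -> R) x v g :
  0 <= L0 -> 0 <= L -> 0 < c -> 0 < eta -> eta * (9 * (L0 + L * c)) <= 1 ->
  let y := x - (eta * clip_factor c g) *: g in
  f y <= f x + dotp v (y - x) + (L0 + L * enorm v) / 2 * enorm (y - x) ^+ 2 ->
  f y <= f x - eta * (clip_factor c v *
           (enorm v ^+ 2 / 2 - 7 * enorm (g - v) ^+ 2)).
Proof.
move=> L00 L_0 c0 eta0 etaL /=; set s := _ * clip_factor c g.
have -> : x - s *: g - x = - (s *: g) by rewrite addrC addKr.
rewrite dotpNr dotpZr enormN enormZ => /le_trans; apply.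
have corr := clipped_correlation v g c0.
have a0 : 0 <= clip_factor c g := clip_factor_ge0 g c0.
rewrite ger0_norm /s; last by rewrite mulr_ge0// ltW.
have ng : enorm g <= enorm v + enorm (g - v).
  by rewrite -[X in enorm X <= _](subrK v) addrC enorm_triangle.
have ac := clipped_norm_le g c0.
have a1 := clip_factor_le1 g c0.
have := enorm_ge0 v; have := enorm_ge0 g; have := enorm_ge0 (g - v).
have := clip_factorP v c0.
move: corr a0 ng ac a1.
move: (clip_factor c v) (clip_factor c g) (dotp v g).
move: (enorm v) (enorm g) (enorm (g - v)) => G n eps w a p corr a0 ng ac a1.
move=> wP eps0 n0 G0.
have an0 : 0 <= a * n by rewrite mulr_ge0.
suff quad : (L0 + L * G) / 2 * (eta * a * n) ^+ 2
         <= eta * (w * (G ^+ 2 / 9 + eps ^+ 2 / 9)).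
  have w0 : 0 <= w by case: wP => [[-> //]|[_ /ltW]].
  have : eta * (w * (G ^+ 2 - 2 * G * eps)) <= eta * a * p.
    by rewrite -[leRHS]mulrA ler_pM2l.
  have : eta * (w * (2 * G * eps)) <= eta * (w * (G ^+ 2 / 6 + 6 * eps ^+ 2)).
    rewrite ler_pM2l// ler_wpM2l//; have := sqr_ge0 (G - 6 * eps); nra.
  have : 0 <= eta * (w * G ^+ 2) by rewrite !mulr_ge0 ?sqr_ge0// ltW.
  have : 0 <= eta * (w * eps ^+ 2) by rewrite !mulr_ge0 ?sqr_ge0// ltW.
  by move=> *; lra.
rewrite (_ : _ / 2 * _ = eta * ((eta * (L0 + L * G)) * (a * n) ^+ 2 / 2)); last by field.
rewrite ler_pM2l//.
case: wP => [[-> Gc]|[cG w0 w1 wG]].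
  have : eta * (L0 + L * G) <= 1 / 9.
    apply: (@le_trans _ _ (eta * (L0 + L * c))); last by lra.
    by rewrite ler_pM2l// lerD2l ler_wpM2l.
  have : (a * n) ^+ 2 <= (G + eps) ^+ 2.
    rewrite ler_pXn2r// ?nnegrE ?addr_ge0// (le_trans _ ng)//.
    by rewrite ler_piMl.
  have := sqr_ge0 (G - eps); have := sqr_ge0 (a * n).
  have : 0 <= eta * (L0 + L * G) by rewrite mulr_ge0 ?(ltW eta0)// addr_ge0// mulr_ge0.
  move: (eta * (L0 + L * G)) ((a * n) ^+ 2) => K q; nra.
have curv : eta * (L0 + L * G) * c <= G / 9.
  have : eta * (L0 + L * c) <= 1 / 9 by lra.
  have : eta * (L0 * c) <= eta * (L0 * G) by rewrite ler_pM2l// ler_wpM2l// ltW.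
  by move=> h1 h2; nra.
have : (a * n) ^+ 2 <= c * c by rewrite expr2 ler_pM.
have K0 : 0 <= eta * (L0 + L * G).
  by rewrite mulr_ge0 ?(ltW eta0)// addr_ge0// mulr_ge0.
move: (eta * (L0 + L * G)) curv K0 ((a * n) ^+ 2) => K curv K0 q qc.
have : w * (G ^+ 2 / 9 + eps ^+ 2 / 9) >= c * G / 9.
  rewrite -wG; have := sqr_ge0 eps; nra.
apply: le_trans.
have : K * q <= K * (c * c) by rewrite ler_wpM2l.
have : K * c * c <= G / 9 * c by rewrite ler_wpM2r// ltW.
have : 0 <= c * G by rewrite mulr_ge0// ltW.
by nra.
Qed.

(** The smoothness bound is tested at distance [l] from [x] against the gradient
    [v], where [h] is still at least [h x0]; convexity turns the resulting lower
    bound on [h x - h x0] into one on the inner product. *)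
Lemma minimizer_gap (L0 L1 l : R) (h : 'rV[R]_d -> R) x x0 v :
  0 <= L0 -> 0 <= L1 -> 0 <= l -> L1 * l <= 1 ->
  h x + dotp v (x0 - x) <= h x0 -> (forall y, h x0 <= h y) ->
  (forall y, L1 * enorm (y - x) <= 1 ->
     h y <= h x + dotp v (y - x) + (L0 + L1 * enorm v) / 2 * enorm (y - x) ^+ 2) ->
  l * enorm v - (L0 + L1 * enorm v) / 2 * l ^+ 2 <= dotp v (x - x0).
Proof.
move=> L00 L10 l0 L1l cvx min smooth.
have [u u1 vu] := unit_direction v.
have yx : x - l *: u - x = - (l *: u) by rewrite addrC addKr.
have yn : enorm (x - l *: u - x) <= l.
  by rewrite yx enormN enormZ ger0_norm// ler_piMr.
have := smooth (x - l *: u); rewrite {2}yx dotpNr dotpZr vu.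
move/(_ (le_trans (ler_wpM2l L10 yn) L1l)) => up.
have : (L0 + L1 * enorm v) / 2 * enorm (x - l *: u - x) ^+ 2 <=
       (L0 + L1 * enorm v) / 2 * l ^+ 2.
  apply: ler_wpM2l; first by rewrite divr_ge0// addr_ge0// mulr_ge0 ?enorm_ge0.
  by rewrite ler_pXn2r ?nnegrE ?enorm_ge0.
have := min (x - l *: u); rewrite -opprB dotpNr in cvx; lra.
Qed.

(** When every sampled function is minimized at [x0], averaging the previous
    gap at the length of the actual step shows that a clipped step does not
    move away from [x0].  The gap is linear in [|v i|] up to a small
    correction, so the mean of the [|v i|] may be replaced by the smaller
    [|g|]. *)
Lemma clipped_step_nonexpansive (L0 L1 c eta : R) (B : nat)
    (h : 'I_B -> 'rV[R]_d -> R) x x0 (v : 'I_B -> 'rV[R]_d) :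
  0 <= L0 -> 0 <= L1 -> 0 < c -> 0 < eta -> eta * (9 * (L0 + L1 * c)) <= 1 ->
  (0 < B)%N ->
  (forall i, h i x + dotp (v i) (x0 - x) <= h i x0) ->
  (forall i y, h i x0 <= h i y) ->
  (forall i y, L1 * enorm (y - x) <= 1 ->
     h i y <= h i x + dotp (v i) (y - x)
               + (L0 + L1 * enorm (v i)) / 2 * enorm (y - x) ^+ 2) ->
  let g := B%:R^-1 *: \sum_(i < B) v i in
  enorm (x - (eta * clip_factor c g) *: g - x0) <= enorm (x - x0).
Proof.
move=> L00 L10 c0 eta0 etaL Bpos cvx min smooth /=.
set g := _%:R^-1 *: _; set a := clip_factor c g.
have a0 : 0 <= a := clip_factor_ge0 g c0.
have ac : a * enorm g <= c := clipped_norm_le g c0.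
have a1 : a <= 1 := clip_factor_le1 g c0.
have n0 := enorm_ge0 g.
pose l := eta * (a * enorm g).
have l0 : 0 <= l by rewrite mulr_ge0 ?mulr_ge0// ltW.
have lc : l <= eta * c by rewrite ler_pM2l.
have L1l : L1 * l <= 1 / 9.
  apply: (@le_trans _ _ (L1 * (eta * c))); first by rewrite ler_wpM2l.
  have : 0 <= eta * L0 by rewrite mulr_ge0// ltW.
  by lra.
have L0l : L0 * l <= enorm g / 9.
  have : L0 * eta <= 1 / 9.
    have : 0 <= eta * (L1 * c) by rewrite !mulr_ge0// ltW.
    by lra.
  have : a * enorm g <= enorm g by rewrite ler_piMl.
  have : 0 <= L0 * eta by rewrite mulr_ge0// ltW.
  rewrite /l; move: (a * enorm g) (mulr_ge0 a0 n0) => q q0.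
  by rewrite mulrA; move: (L0 * eta) => K; nra.
have gap i : l * enorm (v i) * (17 / 18) - L0 / 2 * l ^+ 2 <= dotp (v i) (x - x0).
  have L1l1 : L1 * l <= 1 by lra.
  apply: le_trans (minimizer_gap L00 L10 l0 L1l1 (cvx i) (min i) (@smooth i)).
  have : (L1 * l) * (l * enorm (v i)) <= 1 / 9 * (l * enorm (v i)).
    by rewrite ler_wpM2r// mulr_ge0 ?enorm_ge0.
  by lra.
have B0 : 0 < B%:R :> R by rewrite ltr0n.
have mean : l * enorm g * (17 / 18) - L0 / 2 * l ^+ 2 <= dotp g (x - x0).
  rewrite /g dotpZl dotp_suml ler_pdivlMl//.
  apply: le_trans (ler_sum _ (fun i _ => gap i)).
  rewrite sumrB -mulr_suml -mulr_sumr sumr_const card_ord.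
  rewrite -(mulr_natl (L0 / 2 * _)) mulrBr lerB// mulrA ler_wpM2r// mulrCA ler_wpM2l//.
  by rewrite /g enormZ ger0_norm ?invr_ge0 ?(ltW B0)// mulVKf ?gt_eqF// enorm_sum_le.
rewrite -(ler_pXn2r (_ : 0 < 2)%N) ?nnegrE ?enorm_ge0// addrAC enormB2.
rewrite dotpZr dotpC enormZ ger0_norm; last by rewrite mulr_ge0// ltW.
have : (eta * a * enorm g) ^+ 2 <= 2 * (eta * a * dotp g (x - x0)).
  have -> : (eta * a * enorm g) ^+ 2 = eta * a * (l * enorm g) by rewrite /l; ring.
  rewrite [leRHS]mulrCA ler_wpM2l//; first by rewrite mulr_ge0// ltW.
  have : L0 * l * l <= enorm g / 9 * l by rewrite ler_wpM2r.
  have : 0 <= l * enorm g by rewrite mulr_ge0.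
  by rewrite expr2 in mean; lra.
by lra.
Qed.

End ClippedStep.

(** * Measurability along a measurable trajectory *)

Section MeasurableTrajectory.
Variables (R : realType) (d : nat).
Variables (dT : measure_display) (T : measurableType dT).

(** Working coordinate by coordinate avoids choosing a sigma-algebra on row
    vectors. *)
Definition measurable_coords (U : T -> 'rV[R]_d) :=
  forall i, measurable_fun [set: T] (fun w => U w 0 i).

Lemma measurable_coords_cst x : measurable_coords (fun=> x).
Proof. by move=> i; exact: measurable_cst. Qed.

Lemma measurable_coordsD U V : measurable_coords U -> measurable_coords V ->
  measurable_coords (fun w => U w + V w).
Proof.
move=> mU mV i; under eq_fun do rewrite mxE.
exact: measurable_funD.
Qed.

Lemma measurable_coordsZ (a : T -> R) V :
  measurable_fun [set: T] a -> measurable_coords V ->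
  measurable_coords (fun w => a w *: V w).
Proof.
move=> ma mV i; under eq_fun do rewrite mxE.
exact: measurable_funM.
Qed.

Lemma measurable_coordsB U V : measurable_coords U -> measurable_coords V ->
  measurable_coords (fun w => U w - V w).
Proof.
move=> mU mV i; under eq_fun do rewrite !mxE.
exact: measurable_funB.
Qed.

Lemma measurable_coords_sum n (U : 'I_n -> T -> 'rV[R]_d) :
  (forall j, measurable_coords (U j)) ->
  measurable_coords (fun w => \sum_(j < n) U j w).
Proof.
move=> mU i; under eq_fun do rewrite summxE.
by apply: measurable_sum => j; exact: mU.
Qed.

Lemma measurable_dotp U V : measurable_coords U -> measurable_coords V ->
  measurable_fun [set: T] (fun w => dotp (U w) (V w)).
Proof. by move=> mU mV; apply: measurable_sum => i; exact: measurable_funM. Qed.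

Lemma measurable_enorm2 U : measurable_coords U ->
  measurable_fun [set: T] (fun w => enorm (U w) ^+ 2).
Proof.
by move=> mU; under eq_fun do rewrite enormE; exact: measurable_dotp.
Qed.

Lemma measurable_enorm U : measurable_coords U ->
  measurable_fun [set: T] (fun w => enorm (U w)).
Proof.
move=> mU; apply: measurableT_comp (measurable_dotp mU mU).
by apply: continuous_measurable_fun; exact: sqrt_continuous.
Qed.

(** In this form the clipping factor is visibly continuous in [|g|]. *)
Lemma clip_factorE (c : R) (g : 'rV[R]_d) : 0 < c ->
  clip_factor c g = c / Num.max c (enorm g).
Proof.
move=> c0; have [[-> gc]|[gc _ _ e]] := clip_factorP g c0.
  by rewrite (max_idPl gc) divff ?gt_eqF.
rewrite (max_idPr (ltW gc)) -[in RHS]e mulfK// gt_eqF//.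
exact: lt_trans gc.
Qed.

Lemma measurable_clip_factor (c : R) U : 0 < c -> measurable_coords U ->
  measurable_fun [set: T] (fun w => clip_factor c (U w)).
Proof.
move=> c0 mU; under eq_fun do rewrite clip_factorE//.
apply: (@measurableT_comp _ _ _ _ _ _ (fun t : R => c / Num.max c t)); last first.
  exact: measurable_enorm.
apply: continuous_measurable_fun => t.
apply: cvgMr; apply: cvgV; first by rewrite gt_eqF// lt_max c0.
by apply: continuous_max; [exact: cvg_cst|exact: cvg_id].
Qed.

Section Caratheodory.
Variables (dX : measure_display) (X : measurableType dX).
Variable h : 'rV[R]_d -> X -> R.
Hypothesis mh : forall x, measurable_fun [set: X] (h x).
Variables (Z : T -> X) (mZ : measurable_fun [set: T] Z).

(** Rounding down to the grid of mesh [1 / n.+1] leaves countably many values,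
    and on the event that a given one is taken [h] is evaluated at a fixed
    point. *)
Lemma measurable_comp_grid (n : nat) U : measurable_coords U ->
  measurable_fun [set: T] (fun w =>
    h (\row_i ((Num.floor (n.+1%:R * U w 0 i))%:~R / n.+1%:R)) (Z w)).
Proof.
move=> mU _ A mA; rewrite setTI.
pose E (k : 'rV[int]_d) := [set w | forall i, Num.floor (n.+1%:R * U w 0 i) = k 0 i].
have mE k : measurable (E k).
  have -> : E k = \bigcap_(i in [set: 'I_d])
      (fun w => n.+1%:R * U w 0 i) @^-1` `[(k 0 i)%:~R, (k 0 i + 1)%:~R[%classic.
    apply/seteqP; split=> w; rewrite /E /=.
      move=> wk i _ /=; rewrite in_itv/= -wk.
      exact: floor_itv.
    by move=> wk i; have := wk i I; rewrite /= in_itv/=; exact: floor_def.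
  apply: fin_bigcap_measurable => // i _; rewrite -[X in measurable X]setTI.
  by apply: measurable_funM => //; exact: mU.
pose y (k : 'rV[int]_d) : 'rV[R]_d := \row_i ((k 0 i)%:~R / n.+1%:R).
rewrite (_ : _ @^-1` A = \bigcup_k (E k `&` (Z @^-1` (h (y k) @^-1` A)))).
  apply: countable_bigcupT_measurable; first exact: countableP.
  move=> k; apply: measurableI => //; rewrite -[X in measurable X]setTI.
  apply: mZ => //; rewrite -[X in measurable X]setTI.
  exact: mh.
apply/seteqP; split=> w /=.
  move=> Aw; exists (\row_i Num.floor (n.+1%:R * U w 0 i)) => //.
  split; first by move=> i; rewrite mxE.
  rewrite /= (_ : y _ = \row_i ((Num.floor (n.+1%:R * U w 0 i))%:~R / n.+1%:R))//.
  by apply/rowP => i; rewrite !mxE.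
move=> [k _ [Ek Ak]]; rewrite (_ : \row_i _ = y k)//.
by apply/rowP => i; rewrite !mxE Ek.
Qed.

Lemma measurable_comp_caratheodory U :
  (forall s, continuous (h ^~ s)) -> measurable_coords U ->
  measurable_fun [set: T] (fun w => h (U w) (Z w)).
Proof.
move=> ch mU; apply: (@measurable_fun_cvg _ _ _ _ (fun n w =>
    h (\row_i ((Num.floor (n.+1%:R * U w 0 i))%:~R / n.+1%:R)) (Z w))).
  by move=> n; exact: measurable_comp_grid.
move=> w _; pose y n : 'rV[R]_d :=
  \row_i ((Num.floor (n.+1%:R * U w 0 i))%:~R / n.+1%:R).
suff yU : y @ \oo --> U w by exact: cvg_comp yU (ch (Z w) (U w)).
apply/cvgrPdist_le => e e0.
have [N _ HN] := near_infty_natSinv_lt (PosNum e0).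
exists N => // n /= Nn.
have ne : n.+1%:R^-1 <= e by apply/ltW/(HN n).
rewrite /= /Num.norm/= mx_normrE /y; apply: bigmax_le => [|[j i] _ /=]; first exact: ltW.
rewrite !mxE (ord1 j) (_ : U w 0 i - _ =
   (n.+1%:R * U w 0 i - (Num.floor (n.+1%:R * U w 0 i))%:~R) / n.+1%:R); last first.
  by rewrite mulrBl mulrAC divff ?mul1r// pnatr_eq0.
rewrite normrM [X in _ * X]ger0_norm ?invr_ge0//.
rewrite (le_trans _ ne)// ler_piMl ?invr_ge0//.
have /andP[fl] := floor_itv (n.+1%:R * U w 0 i).
by rewrite intrD ger0_norm ?subr_ge0// => fl1; lra.
Qed.

Hypothesis dh : forall s x, differentiable (h ^~ s) x.

(** Partial derivatives are limits of difference quotients, which are values of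
    [h] along two measurable trajectories. *)
Lemma measurable_grad U : measurable_coords U ->
  measurable_coords (fun w => grad (h ^~ (Z w)) (U w)).
Proof.
move=> mU i; under eq_fun do rewrite mxE.
have ch s : continuous (h ^~ s) by move=> x; apply: differentiable_continuous.
pose v : 'rV[R]_d := delta_mx 0 i.
apply: (@measurable_fun_cvg _ _ _ _ (fun n w => (n.+1%:R^-1)^-1 *
    (h (n.+1%:R^-1 *: v + U w) (Z w) - h (U w) (Z w)))).
  move=> n; apply: measurable_funM => //; apply: measurable_funB.
    apply: measurable_comp_caratheodory => //.
    by apply: measurable_coordsD => //; exact: measurable_coords_cst.
  exact: measurable_comp_caratheodory.
move=> w _.
have := @diff_derivable _ _ _ _ _ v (dh (Z w) (U w)).
move=> /cvg_ex[l lE]; rewrite /derive (cvg_lim _ lE)//.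
have /cvgr_dnbhsP := lE; apply; split; last exact: cvg_harmonic.
by move=> n; rewrite invr_neq0// pnatr_eq0.
Qed.

End Caratheodory.

End MeasurableTrajectory.

Section MeasurableIterates.
Variables (R : realType) (d : nat).
Variables (dT : measure_display) (T : measurableType dT).
Variables (dX : measure_display) (X : measurableType dX).
Variable F : 'rV[R]_d -> X -> R.
Hypothesis mF : forall x, measurable_fun [set: X] (F x).
Hypothesis dF : forall s x, differentiable (F ^~ s) x.
Variable B : nat.

Lemma measurable_minibatch_grad (Z : 'I_B -> T -> X) U :
  (forall i, measurable_fun [set: T] (Z i)) -> measurable_coords U ->
  measurable_coords (fun w => minibatch_grad F (fun i => Z i w) (U w)).
Proof.
move=> mZ mU; apply: measurable_coordsZ; first exact: measurable_cst.
by apply: measurable_coords_sum => i; exact: measurable_grad.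
Qed.

(** The sigma-algebra of [T] is only asked to see the samples of the steps
    before [k]: this is what makes the k-th iterate independent of the k-th
    batch. *)
Lemma measurable_clipSGD (xi : nat -> 'I_B -> T -> X) eta c x0 k : 0 < c ->
  (forall l i, (l < k)%N -> measurable_fun [set: T] (xi l i)) ->
  measurable_coords (fun w => clipSGD F eta c x0 (fun l i => xi l i w) k).
Proof.
move=> c0; elim: k => [|k IH] mxi /=; first exact: measurable_coords_cst.
have mx := IH (fun l i lk => mxi l i (ltnW lk)).
have mg := measurable_minibatch_grad (fun i => mxi k i (ltnSn k)) mx.
apply: measurable_coordsB => //; apply: measurable_coordsZ => //.
by apply: measurable_funM; [exact: measurable_cst|exact: measurable_clip_factor].
Qed.

End MeasurableIterates.

(** * Independence and the freezing of the past *)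

Section Freezing.
Local Open Scope ereal_scope.
Variables (R : realType) (dO dT dX : measure_display).
Variables (Omega : measurableType dO) (T : measurableType dT)
  (X : measurableType dX).
Variables (P : probability Omega R) (D : probability X R).
Variables (U : {RV P >-> T}) (Z : {RV P >-> X}).
Hypothesis indep_law : forall A S, measurable A -> measurable S ->
  P (U @^-1` A `&` Z @^-1` S) = P (U @^-1` A) * D S.

Let UZ w := (U w, Z w).

Let mUZ : measurable_fun [set: Omega] UZ.
Proof. exact: measurable_fun_pair. Qed.

Lemma joint_lawE C : measurable C ->
  (distribution P U \x D) C = pushforward P UZ C.
Proof.
by move=> mC; exact: product_measure_unique.
Qed.

Lemma integral_joint_law (f : T * X -> \bar R) :
  \int[pushforward P UZ]_z f z = \int[distribution P U \x D]_z f z.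
Proof. by apply: eq_measure_integral => A mA _; exact/esym/joint_lawE. Qed.

(** By independence the joint law is a product, and Tonelli's theorem integrates
    [Z] out at fixed [U]. *)
Lemma freezing_ge0 (f : T * X -> \bar R) :
  measurable_fun [set: T * X] f -> (forall z, 0 <= f z) ->
  \int[P]_w f (U w, Z w) = \int[P]_w \int[D]_s f (U w, s).
Proof.
move=> mf f0.
rewrite -(@ge0_integral_pushforward _ _ _ _ _ UZ mUZ P setT f)//.
rewrite integral_joint_law fubini_tonelli1// ge0_integral_distribution//.
- exact: measurable_fun_fubini_tonelli_F.
- by move=> x; exact: integral_ge0.
Qed.

Lemma freezing_mean0 (f : T * X -> \bar R) :
  measurable_fun [set: T * X] f ->
  P.-integrable [set: Omega] (fun w => f (U w, Z w)) ->
  (forall x, \int[D]_s f (x, s) = 0) ->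
  \int[P]_w f (U w, Z w) = 0.
Proof.
move=> mf intf mean0.
have intf' : (distribution P U \x D).-integrable [set: T * X] f.
  apply/integrableP; split=> //.
  rewrite -integral_joint_law ge0_integral_pushforward//.
  - by have /integrableP[] := intf.
  - exact: measurableT_comp.
rewrite -(@integral_pushforward _ _ _ _ _ UZ mUZ P setT f)//.
rewrite integral_joint_law -integral12_prod_meas1//.
by under eq_integral do rewrite /fubini_F mean0; rewrite integral0.
Qed.

End Freezing.

Section Cylinders.
Variables (R : realType) (dO dX : measure_display).
Variables (Omega : measurableType dO) (X : measurableType dX).
Variables (P : probability Omega R) (D : probability X R).
Variables (I : choiceType) (Y : I -> {RV P >-> X}).

(** A pi-system that generates the sigma-algebra of everything but [Y i0]. *)
Definition cylinders_off (i0 : I) : set (set Omega) :=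
  [set A | exists J : {fset I}, exists S : I -> set X,
     [/\ i0 \notin J, forall i, measurable (S i)
       & A = \bigcap_(i in [set` J]) (Y i @^-1` S i)]].

Lemma cylinders_off_measurable i0 : cylinders_off i0 `<=` measurable.
Proof.
move=> A [J [S [_ mS ->]]]; apply: fin_bigcap_measurable => // i _.
by rewrite -[X in measurable X]setTI; exact: measurable_funP.
Qed.

Lemma cylinders_off_setI i0 : setI_closed (cylinders_off i0).
Proof.
move=> _ _ [J1 [S1 [n1 mS1 ->]]] [J2 [S2 [n2 mS2 ->]]].
exists (J1 `|` J2)%fset.
exists (fun i => (if i \in J1 then S1 i else setT) `&` (if i \in J2 then S2 i else setT)).
split; first by rewrite in_fsetU negb_or n1.
  by move=> i; apply: measurableI; case: ifP.
apply/seteqP; split=> w /=.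
  move=> [w1 w2] i /=; rewrite in_fsetU => _; split.
    by case: ifPn => // iJ; exact: w1.
  by case: ifPn => // iJ; exact: w2.
move=> w12; split=> i /= iJ.
  by have [] := w12 i; rewrite /= ?in_fsetU iJ.
by have [] := w12 i; rewrite /= ?in_fsetU iJ ?orbT.
Qed.

Lemma cylinders_off_setT i0 : cylinders_off i0 setT.
Proof.
exists fset0, (fun=> setT); split=> //.
by apply/seteqP; split.
Qed.

Definition sigma_off i0 : measurableType _ :=
  g_sigma_algebraType (cylinders_off i0).

Lemma measurable_id_sigma_off i0 :
  measurable_fun [set: Omega] (idfun : Omega -> sigma_off i0).
Proof.
move=> _ A mA; rewrite setTI preimage_id; move: A mA.
apply: smallest_sub; first exact: sigma_algebra_measurable.
exact: cylinders_off_measurable.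
Qed.

Lemma measurable_sigma_off i0 i : i != i0 ->
  measurable_fun [set: sigma_off i0] (Y i).
Proof.
move=> ii0 _ A mA; rewrite setTI; apply: sub_sigma_algebra.
exists [fset i]%fset, (fun=> A); split=> //; first by rewrite in_fset1 eq_sym.
apply/seteqP; split=> w /= Aw.
  by move=> j /=; rewrite in_fset1 => /eqP ->.
by apply: Aw; rewrite /= in_fset1.
Qed.

Hypothesis indep : mutually_independent Y.

(** Both sides are finite measures in [A]; they agree on the cylinders by mutual
    independence, hence on the sigma-algebra that these generate. *)
Lemma independent_off i0 (A : set (sigma_off i0)) S :
  measurable A -> measurable S ->
  P (A `&` Y i0 @^-1` S) = (P A * P (Y i0 @^-1` S))%E.
Proof.
move=> mA mS.
have mYS : measurable (Y i0 @^-1` S).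
  by rewrite -[X in measurable X]setTI; exact: measurable_funP.
have pfin : P (Y i0 @^-1` S) \is a fin_num by exact: fin_num_measure.
pose m1 := mrestr P mYS.
pose p := NngNum (fine_ge0 (measure_ge0 P (Y i0 @^-1` S))).
pose m2 := mscale p P.
have m2E C : m2 C = (P C * P (Y i0 @^-1` S))%E.
  by rewrite /m2 /mscale /= fineK// muleC.
rewrite -m2E; suff : m1 A = m2 A by [].
apply: (@g_sigma_algebra_measure_unique _ R Omega (cylinders_off i0)
  (@cylinders_off_measurable i0) (fun=> setT)) => //.
- by move=> _; exact: cylinders_off_setT.
- by rewrite bigcup_const//; exists 0%N.
- exact: cylinders_off_setI.
- move=> _ [J [T [i0J mT ->]]]; rewrite -[RHS]/(m2 _) m2E -[LHS]/(P (_ `&` _)).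
  have ne i : i \in J -> i != i0 by move=> iJ; apply: contraNneq i0J => <-.
  pose T' i := if i == i0 then S else T i.
  have T'E i : i \in J -> T' i = T i by move=> /ne/negbTE; rewrite /T' => ->.
  have -> : (\bigcap_(i in [set` J]) Y i @^-1` T i) `&` Y i0 @^-1` S =
            \bigcap_(i in [set` (i0 |` J)%fset]) Y i @^-1` T' i.
    apply/seteqP; split=> w /=.
      move=> [wT wS] i /=; rewrite in_fset1U /T'.
      by case: eqVneq => [-> //|_ /= iJ]; exact: wT.
    move=> wT; split; last first.
      by have := wT i0; rewrite /= fset1U1 /T' eqxx; exact.
    by move=> i /= iJ; rewrite -T'E//; apply: wT; rewrite /= in_fset1U iJ orbT.
  rewrite indep; last by move=> i _; rewrite /T'; case: ifP.
  rewrite indep; last by move=> i _.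
  rewrite big_fsetU1// [X in (X * _)%E = _](_ : _ = P (Y i0 @^-1` S)).
    rewrite muleC; congr (_ * _)%E.
    by apply: eq_big_seq => i iJ; rewrite T'E.
  by rewrite /T' eqxx.
- move=> _; rewrite -[X in (X < _)%E]/(P (_ `&` _)) setTI.
  by rewrite (le_lt_trans (probability_le1 _ _))// ltry.
Qed.

End Cylinders.

Section FreezingOff.
Variables (R : realType) (dO dX : measure_display).
Variables (Omega : measurableType dO) (X : measurableType dX).
Variables (P : probability Omega R) (D : probability X R).
Variables (I : choiceType) (Y : I -> {RV P >-> X}).
Hypothesis indep : mutually_independent Y.
Variable i0 : I.
Hypothesis law : forall S, measurable S -> P (Y i0 @^-1` S) = D S.

Local Notation T := (sigma_off Y i0).

(** The outcome, known up to everything but [Y i0]. *)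
Let mrest := @measurable_id_sigma_off _ _ _ _ _ _ _ Y i0.
Let mrest_mixin := isMeasurableFun.Build _ _ _ _ _ mrest.
Let rest : {RV P >-> T} := HB.pack (idfun : Omega -> T) mrest_mixin.

Let indep_law (A : set T) (S : set X) : measurable A -> measurable S ->
  P (rest @^-1` A `&` Y i0 @^-1` S) = (P (rest @^-1` A) * D S)%E.
Proof. by move=> mA mS; rewrite -law// independent_off. Qed.

Local Open Scope ereal_scope.

Lemma freezing_off_le (f : T * X -> \bar R) (b : T -> \bar R) :
  measurable_fun [set: T * X] f -> (forall z, 0 <= f z) ->
  measurable_fun [set: T] b -> (forall w, \int[D]_s f (w, s) <= b w) ->
  \int[P]_w f (w, Y i0 w) <= \int[P]_w b w.
Proof.
move=> mf f0 mb fb.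
have b0 w : 0 <= b w by apply: le_trans (fb w); exact: integral_ge0.
rewrite (freezing_ge0 indep_law mf f0).
have mF : measurable_fun [set: T] (fun w => \int[D]_s f (w, s)).
  exact: measurable_fun_fubini_tonelli_F.
apply: ge0_le_integral => //.
- by move=> w _; exact: integral_ge0.
- exact: (measurableT_comp mF mrest).
- exact: (measurableT_comp mb mrest).
Qed.

Lemma freezing_off_mean0 (f : T * X -> \bar R) :
  measurable_fun [set: T * X] f ->
  P.-integrable [set: Omega] (fun w => f (w, Y i0 w)) ->
  (forall w, \int[D]_s f (w, s) = 0) ->
  \int[P]_w f (w, Y i0 w) = 0.
Proof. exact: (freezing_mean0 indep_law). Qed.

End FreezingOff.

(** * Means of real random variables *)

Section Mean.
Variables (R : realType) (dT : measure_display) (T : measurableType dT).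
Variable P : probability T R.
Implicit Types f g : T -> R.

Definition integrable_fun f := P.-integrable [set: T] (EFin \o f).

Lemma integrable_funD f g : integrable_fun f -> integrable_fun g ->
  integrable_fun (fun x => f x + g x).
Proof. by move=> fi gi; exact: (integrableD measurableT fi gi). Qed.

Lemma integrable_funB f g : integrable_fun f -> integrable_fun g ->
  integrable_fun (fun x => f x - g x).
Proof. by move=> fi gi; exact: (integrableB measurableT fi gi). Qed.

Lemma integrable_funZ (a : R) f : integrable_fun f ->
  integrable_fun (fun x => a * f x).
Proof. by move=> fi; exact: (integrableZl measurableT a fi). Qed.

Lemma integrable_fun_cst (a : R) : integrable_fun (fun=> a).
Proof. exact: finite_measure_integrable_cst. Qed.

Lemma integrable_fun_sum n (f : 'I_n -> T -> R) :
  (forall i, integrable_fun (f i)) -> integrable_fun (fun x => \sum_(i < n) f i x).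
Proof.
move=> fi; rewrite /integrable_fun.
rewrite (_ : EFin \o _ = fun x => (\sum_(i < n) (f i x)%:E)%E).
  by apply: (integrable_sum measurableT) => i _; exact: fi.
by apply/funext => x; rewrite /= sumEFin.
Qed.

Lemma le_integrable_fun f g : measurable_fun [set: T] f ->
  (forall x, `|f x| <= g x) -> integrable_fun g -> integrable_fun f.
Proof.
move=> mf fg; apply: (le_integrable measurableT); first exact/measurable_EFinP.
by move=> x _ /=; rewrite lee_fin (le_trans (fg x))// ler_norm.
Qed.

Lemma bounded_integrable_fun f (M : R) : measurable_fun [set: T] f ->
  (forall x, `|f x| <= M) -> integrable_fun f.
Proof. by move=> mf fM; apply: le_integrable_fun (integrable_fun_cst M). Qed.

Lemma ge0_integrable_fun f (M : R) : measurable_fun [set: T] f ->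
  (forall x, 0 <= f x) -> (\int[P]_x (f x)%:E <= M%:E)%E -> integrable_fun f.
Proof.
move=> mf f0 fM; apply/integrableP; split; first exact/measurable_EFinP.
rewrite (eq_integral (EFin \o f)); last by move=> x _ /=; rewrite ger0_norm.
by rewrite (le_lt_trans fM)// ltry.
Qed.

Lemma EFin_mean f : integrable_fun f -> (\int[P]_x (f x)%:E)%E = (\int[P]_x f x)%:E.
Proof. by move=> fi; rewrite /Rintegral fineK//; exact: integrable_fin_num. Qed.

Lemma mean_cst (a : R) : \int[P]_x a = a.
Proof.
rewrite Rintegral_cst// (_ : fine _ = 1) ?mulr1//.
by have := probability_setT P => /= ->.
Qed.

Lemma mean_sum n (f : 'I_n -> T -> R) : (forall i, integrable_fun (f i)) ->
  \int[P]_x (\sum_(i < n) f i x) = \sum_(i < n) \int[P]_x f i x.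
Proof.
move=> fi; apply: EFin_inj; rewrite -EFin_mean; last exact: integrable_fun_sum.
under eq_integral do rewrite -sumEFin.
rewrite integral_sum// -sumEFin; apply: eq_bigr => i _.
exact: EFin_mean.
Qed.

Lemma le_mean_ae f g : integrable_fun f -> integrable_fun g ->
  {ae P, forall x, f x <= g x} -> \int[P]_x f x <= \int[P]_x g x.
Proof.
move=> fi gi fg.
rewrite -subr_ge0 -RintegralB//.
have hi := integrable_funB gi fi.
have mh : measurable_fun [set: T] (fun x => g x - f x).
  by apply/measurable_EFinP; have /integrableP[] := hi.
rewrite /Rintegral (ae_eq_integral (fun x => (Num.max (g x - f x) 0)%:E))//.
- by apply: fine_ge0; apply: integral_ge0 => x _; rewrite lee_fin le_max lexx orbT.
- exact/measurable_EFinP.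
- by apply/measurable_EFinP; apply: measurable_maxr.
- by apply: filterS fg => x fgx _; rewrite (max_idPl _)// subr_ge0.
Qed.

Lemma le_mean f g : integrable_fun f -> integrable_fun g ->
  (forall x, f x <= g x) -> \int[P]_x f x <= \int[P]_x g x.
Proof. by move=> fi gi fg; apply: le_mean_ae => //; exact: aeW. Qed.

Lemma meanD f g : integrable_fun f -> integrable_fun g ->
  \int[P]_x (f x + g x) = \int[P]_x f x + \int[P]_x g x.
Proof. by move=> fi gi; rewrite RintegralD. Qed.

Lemma meanB f g : integrable_fun f -> integrable_fun g ->
  \int[P]_x (f x - g x) = \int[P]_x f x - \int[P]_x g x.
Proof. by move=> fi gi; rewrite RintegralB. Qed.

Lemma meanZ (a : R) f : integrable_fun f ->
  \int[P]_x (a * f x) = a * \int[P]_x f x.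
Proof. by move=> fi; rewrite RintegralZl. Qed.

End Mean.

(** * The objective inherits convexity and smoothness *)

Section Objective.
Variables (R : realType) (d : nat) (dX : measure_display).
Variables (X : measurableType dX) (D : probability X R) (F : 'rV[R]_d -> X -> R).
Hypothesis F_integrable : forall x, D.-integrable [set: X] (fun s => (F x s)%:E).
Hypothesis F_differentiable : forall s x, differentiable (F ^~ s) x.
Hypothesis F_unbiased : unbiased D F.

Local Notation f := (objective D F).
Local Notation df := (grad (objective D F)).
Local Notation sg := (stoch_grad F).

Lemma measurable_sample x : measurable_fun [set: X] (F x).
Proof. by apply/measurable_EFinP; have /integrableP[] := F_integrable x. Qed.

Lemma objectiveE x : f x = \int[D]_s F x s.
Proof. by rewrite /objective unlock. Qed.

Lemma measurable_stoch_grad x : measurable_coords (sg x).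
Proof.
by apply: (measurable_grad measurable_sample) => //; exact: measurable_coords_cst.
Qed.

Lemma integrable_sg_coord x i : integrable_fun D (fun s => sg x s 0 i).
Proof. by have [] := F_unbiased x i. Qed.

Lemma mean_sg_coord x i : \int[D]_s sg x s 0 i = df x 0 i.
Proof. by have [_] := F_unbiased x i; rewrite unlock /Rintegral => ->. Qed.

Lemma integrable_dotp_sg x u : integrable_fun D (fun s => dotp (sg x s) u).
Proof.
apply: integrable_fun_sum => i; under eq_fun do rewrite mulrC.
exact/integrable_funZ/integrable_sg_coord.
Qed.

Lemma mean_dotp_sg x u : \int[D]_s dotp (sg x s) u = dotp (df x) u.
Proof.
have zi i : integrable_fun D (fun s => sg x s 0 i * u 0 i).
  under eq_fun do rewrite mulrC.
  exact/integrable_funZ/integrable_sg_coord.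
rewrite mean_sum//; apply: eq_bigr => i _.
under eq_Rintegral do rewrite mulrC.
by rewrite meanZ ?mean_sg_coord 1?mulrC//; exact: integrable_sg_coord.
Qed.

Variable rho : R.
Hypothesis rho_ge1 : 1 <= rho.
Hypothesis F_strong_growth : strong_growth D F rho.

Lemma integrable_sg2 x : integrable_fun D (fun s => enorm (sg x s) ^+ 2).
Proof.
apply: (ge0_integrable_fun (M := rho * enorm (df x) ^+ 2)).
- exact/measurable_enorm2/measurable_stoch_grad.
- by move=> s; exact: sqr_ge0.
- by have := F_strong_growth x; rewrite unlock.
Qed.

Lemma mean_sg2_le x : \int[D]_s (enorm (sg x s) ^+ 2) <= rho * enorm (df x) ^+ 2.
Proof.
have := F_strong_growth x; rewrite unlock.
by rewrite (EFin_mean (integrable_sg2 x)) lee_fin.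
Qed.

Lemma integrable_enorm_sg x : integrable_fun D (fun s => enorm (sg x s)).
Proof.
have i2 := integrable_funD (integrable_fun_cst D 1) (integrable_sg2 x).
apply: le_integrable_fun i2 => [|s]; first exact/measurable_enorm/measurable_stoch_grad.
rewrite ger0_norm ?enorm_ge0//; have := sqr_ge0 (enorm (sg x s) - 1).
by have := sqr_ge0 (enorm (sg x s)); lra.
Qed.

(** Jensen's inequality for the square, through the bound
    [2 * t * |g| <= |g| ^ 2 + t ^ 2] with [t] the mean of [|g|]. *)
Lemma mean_enorm_sg_le x :
  \int[D]_s enorm (sg x s) <= Num.sqrt rho * enorm (df x).
Proof.
have rho0 : 0 <= rho by rewrite (le_trans ler01).
have key t : 2 * t * \int[D]_s enorm (sg x s) <= (Num.sqrt rho * enorm (df x)) ^+ 2 + t ^+ 2.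
  rewrite exprMn sqr_sqrtr//.
  apply: (@le_trans _ _ (\int[D]_s (enorm (sg x s) ^+ 2 + t ^+ 2))).
    rewrite -meanZ; last exact: integrable_enorm_sg.
    apply: le_mean.
    - exact/integrable_funZ/integrable_enorm_sg.
    - by apply: integrable_funD; [exact: integrable_sg2|exact: integrable_fun_cst].
    - by move=> s; have := sqr_ge0 (enorm (sg x s) - t); lra.
  rewrite meanD; [|exact: integrable_sg2|exact: integrable_fun_cst].
  by rewrite mean_cst lerD2r; exact: mean_sg2_le.
set m := \int[D]_s _ in key *; set K := _ * enorm _ in key *.
have K0 : 0 <= K by rewrite mulr_ge0 ?enorm_ge0// sqrtr_ge0.
have [//|Km] := leP m K.
by have := key m; nra.
Qed.

Definition sg_error x s := sg x s - df x.

Lemma integrable_dotp_error x u : integrable_fun D (fun s => dotp u (sg_error x s)).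
Proof.
under eq_fun do rewrite dotpC dotpBl.
by apply: integrable_funB; [exact: integrable_dotp_sg|exact: integrable_fun_cst].
Qed.

Lemma mean_dotp_error x u : \int[D]_s dotp u (sg_error x s) = 0.
Proof.
under eq_Rintegral do rewrite dotpC dotpBl.
rewrite meanB; [|exact: integrable_dotp_sg|exact: integrable_fun_cst].
by rewrite mean_cst mean_dotp_sg subrr.
Qed.

Lemma error2E x s : enorm (sg_error x s) ^+ 2 =
  enorm (sg x s) ^+ 2 - (2 * dotp (sg x s) (df x) - enorm (df x) ^+ 2).
Proof. by rewrite /sg_error enormB2; ring. Qed.

Lemma integrable_error2 x : integrable_fun D (fun s => enorm (sg_error x s) ^+ 2).
Proof.
under eq_fun do rewrite error2E.
apply: integrable_funB; first exact: integrable_sg2.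
apply: integrable_funB; last exact: integrable_fun_cst.
exact/integrable_funZ/integrable_dotp_sg.
Qed.

Lemma mean_error2_le x :
  \int[D]_s (enorm (sg_error x s) ^+ 2) <= (rho - 1) * enorm (df x) ^+ 2.
Proof.
under eq_Rintegral do rewrite error2E.
have i2 : integrable_fun D (fun s => 2 * dotp (sg x s) (df x)).
  exact/integrable_funZ/integrable_dotp_sg.
have ic := integrable_fun_cst D (enorm (df x) ^+ 2).
rewrite meanB; [|exact: integrable_sg2|exact: integrable_funB].
rewrite meanB// meanZ; last exact: integrable_dotp_sg.
rewrite mean_cst mean_dotp_sg -enormE.
by have := mean_sg2_le x; lra.
Qed.

Variables L0 L1 : R.
Hypotheses (L0_ge0 : 0 <= L0) (L1_ge0 : 0 <= L1).
Hypothesis F_smooth : {ae D, forall s, L0L1_smooth_convex L0 L1 (F ^~ s)}.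

Lemma objective_convex x y : f x + dotp (df x) (y - x) <= f y.
Proof.
rewrite !objectiveE -mean_dotp_sg -meanD; [|exact: F_integrable|exact: integrable_dotp_sg].
apply: le_mean_ae.
- by apply: integrable_funD; [exact: F_integrable|exact: integrable_dotp_sg].
- exact: F_integrable.
- apply: filterS F_smooth => s smooth.
  have [] := smooth x y y; last by [].
  by rewrite subrr enorm0 mulr0 ler01.
Qed.

Lemma objective_smooth y z : L1 * enorm (y - z) <= 1 ->
  f y <= f z + dotp (df z) (y - z)
         + (L0 + Num.sqrt rho * L1 * enorm (df z)) / 2 * enorm (y - z) ^+ 2.
Proof.
move=> yz; set q := enorm (y - z) ^+ 2.
have q0 : 0 <= q := sqr_ge0 _.
have i1 : integrable_fun D (fun s => F z s + dotp (sg z s) (y - z)).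
  by apply: integrable_funD; [exact: F_integrable|exact: integrable_dotp_sg].
have i2 : integrable_fun D (fun s => L0 * q / 2 + L1 * q / 2 * enorm (sg z s)).
  apply: integrable_funD; first exact: integrable_fun_cst.
  exact/integrable_funZ/integrable_enorm_sg.
apply: (@le_trans _ _ (\int[D]_s ((F z s + dotp (sg z s) (y - z)) +
    (L0 * q / 2 + L1 * q / 2 * enorm (sg z s))))).
  rewrite objectiveE; apply: le_mean_ae.
  - exact: F_integrable.
  - exact: integrable_funD.
  - apply: filterS F_smooth => s smooth.
    by have [_] := smooth z y z yz; rewrite -/q /stoch_grad; lra.
rewrite meanD// meanD; [|exact: F_integrable|exact: integrable_dotp_sg].
rewrite meanD; [|exact: integrable_fun_cst|exact/integrable_funZ/integrable_enorm_sg].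
rewrite (meanZ (L1 * q / 2)); last exact: integrable_enorm_sg.
rewrite mean_cst -objectiveE mean_dotp_sg lerD2l.
have : L1 * q / 2 * \int[D]_s enorm (sg z s) <=
       L1 * q / 2 * (Num.sqrt rho * enorm (df z)).
  by rewrite ler_wpM2l ?mean_enorm_sg_le// divr_ge0// mulr_ge0.
by lra.
Qed.

Variable xstar : 'rV[R]_d.
Hypothesis xstar_min : forall x, f xstar <= f x.

(** For small [t] a step of length [t * |v|] against the gradient [v] decreases
    the objective by at least [t * |v| ^ 2 / 2], impossible at a minimizer. *)
Lemma grad_objective_min : df xstar = 0.
Proof.
apply/enorm0_eq0; set v := df xstar; set K := L0 + Num.sqrt rho * L1 * enorm v.
have K0 : 0 <= K by rewrite addr_ge0// !mulr_ge0 ?sqrtr_ge0 ?enorm_ge0.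
(* [t] is small enough for the smoothness bound to apply and for its quadratic
   term to cost at most half of the linear gain. *)
pose t := (1 + L1 * enorm v + K)^-1.
have d0 : 0 < 1 + L1 * enorm v + K.
  by rewrite -addrA ltr_pwDl// addr_ge0// mulr_ge0 ?enorm_ge0.
have t0 : 0 < t by rewrite invr_gt0.
have td : t * (1 + L1 * enorm v + K) = 1 by rewrite mulVf// gt_eqF.
have tL : t * (L1 * enorm v) <= 1.
  have : 0 <= t * K by rewrite mulr_ge0// ltW.
  by lra.
have tK : t * K <= 1.
  have : 0 <= t * (L1 * enorm v) by rewrite !mulr_ge0 ?enorm_ge0// ltW.
  by lra.
have := @objective_smooth (xstar - t *: v) xstar.
have -> : xstar - t *: v - xstar = - (t *: v) by rewrite addrC addKr.
rewrite enormN dotpNr dotpZr -enormE -/v -/K enormZ (gtr0_norm t0) => smooth.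
have {}smooth : f (xstar - t *: v) <=
   f xstar - t * enorm v ^+ 2 + K / 2 * (t * enorm v) ^+ 2 by apply: smooth; lra.
have low := xstar_min (xstar - t *: v).
have q0 := sqr_ge0 (enorm v).
have tq0 : 0 <= t * enorm v ^+ 2 by rewrite mulr_ge0// ltW.
have tq : t * enorm v ^+ 2 <= 0.
  have : (t * K) * (t * enorm v ^+ 2) <= 1 * (t * enorm v ^+ 2) by rewrite ler_wpM2r.
  by lra.
have /eqP : t * enorm v ^+ 2 = 0 by apply/eqP; rewrite eq_le tq tq0.
by rewrite mulf_eq0 gt_eqF//= sqrf_eq0 => /eqP.
Qed.

(** Strong growth forces interpolation: a minimizer of the mean is a stationary
    point of almost every sample. *)
Lemma sg_min_ae0 : {ae D, forall s, sg xstar s = 0}.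
Proof.
have m2 : measurable_fun [set: X] (fun s => (enorm (sg xstar s) ^+ 2)%:E).
  exact/measurable_EFinP/measurable_enorm2/measurable_stoch_grad.
have [+ _] := ae_eq_integral_abs D measurableT m2.
have -> : (\int[D]_s `|(enorm (sg xstar s) ^+ 2)%:E| = 0)%E.
  apply/eqP; rewrite eq_le integral_ge0// andbT.
  rewrite (eq_integral (fun s => (enorm (sg xstar s) ^+ 2)%:E)); last first.
    by move=> s _; rewrite gee0_abs// lee_fin sqr_ge0.
  have := F_strong_growth xstar.
  by rewrite unlock grad_objective_min enorm0 expr0n mulr0.
move=> /(_ erefl); apply: filterS => s /(_ I)[] /eqP.
by rewrite sqrf_eq0 => /eqP/enorm0_eq0.
Qed.

End Objective.

(** * The trajectory of clipped stochastic gradient descent *)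

Section Trajectory.
Variables (R : realType) (d : nat) (dX : measure_display).
Variables (X : measurableType dX) (D : probability X R) (F : 'rV[R]_d -> X -> R).
Hypothesis F_integrable : forall x, D.-integrable [set: X] (fun s => (F x s)%:E).
Hypothesis F_differentiable : forall s x, differentiable (F ^~ s) x.
Hypothesis f_differentiable : forall x, differentiable (objective D F) x.
Variable xstar : 'rV[R]_d.
Hypothesis xstar_min : forall x, objective D F xstar <= objective D F x.
Variables L0 L1 : R.
Hypotheses (L0_ge0 : 0 <= L0) (L1_ge0 : 0 <= L1).
Hypothesis F_smooth : {ae D, forall s, L0L1_smooth_convex L0 L1 (F ^~ s)}.
Hypothesis F_unbiased : unbiased D F.
Variable rho : R.
Hypotheses (rho_ge1 : 1 <= rho) (F_strong_growth : strong_growth D F rho).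
Variable B : nat.
Hypotheses (B_ge1 : (1 <= B)%N) (B_large : 36 * (rho - 1) <= B%:R).
Variable c : R.
Hypothesis c_gt0 : 0 < c.
Variable eta : R.
Hypothesis eta_gt0 : 0 < eta.
Hypothesis eta_small : eta * (9 * (L0 + Num.sqrt rho * L1 * c)) <= 1.
Variables (dO : measure_display) (Omega : measurableType dO) (P : probability Omega R).
Variable xi : nat -> 'I_B -> {RV P >-> X}.
Hypothesis xi_iid : iid_samples D xi.
Variable x0 : 'rV[R]_d.

Local Notation f := (objective D F).
Local Notation df := (grad (objective D F)).
Local Notation sg := (stoch_grad F).
Local Notation err := (sg_error D F).

Definition iterate k w := clipSGD F eta c x0 (fun l i => xi l i w) k.
Definition batch_grad k w := minibatch_grad F (fun i => xi k i w) (iterate k w).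

(** The clipping factor that the exact gradient would receive; unlike the one
    used by the algorithm it does not depend on the current batch. *)
Definition weight k w := clip_factor c (df (iterate k w)).

Let mF x : measurable_fun [set: X] (F x).
Proof. exact: (measurable_sample F_integrable). Qed.

Let sqrt_rho_ge1 : 1 <= Num.sqrt rho.
Proof. by rewrite -[leLHS]sqrtr1 ler_wsqrtr. Qed.

Let step_L1 : L1 * (eta * c) <= 1 / 9.
Proof.
have : L1 * c <= Num.sqrt rho * L1 * c by rewrite ler_wpM2r ?(ltW c_gt0)// ler_peMl.
rewrite -(ler_pM2l eta_gt0) => h.
have : 0 <= eta * L0 by rewrite mulr_ge0// ltW.
by move: eta_small h; lra.
Qed.

Let step_sample : eta * (9 * (L0 + L1 * c)) <= 1.
Proof.
apply: le_trans eta_small; rewrite ler_pM2l// ler_wpM2l// lerD2l.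
by rewrite ler_wpM2r ?(ltW c_gt0)// ler_peMl.
Qed.

Section MeasurableGradient.
Variables (dT : measure_display) (T : measurableType dT).

Lemma measurable_objective_comp (U : T -> 'rV[R]_d) : measurable_coords U ->
  measurable_fun [set: T] (fun w => f (U w)).
Proof.
move=> mU; apply: (@measurable_comp_caratheodory _ _ _ _ _ T (fun x _ => f x) _ idfun) => //.
- exact: measurable_id.
- by move=> _ x; exact/differentiable_continuous/f_differentiable.
Qed.

Lemma measurable_df_comp (U : T -> 'rV[R]_d) : measurable_coords U ->
  measurable_coords (fun w => df (U w)).
Proof.
move=> mU; apply: (@measurable_grad _ _ _ _ _ T (fun x _ => f x) _ idfun) => //.
exact: measurable_id.
Qed.

End MeasurableGradient.

Lemma measurable_iterate k : measurable_coords (iterate k).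
Proof. by apply: measurable_clipSGD => // l i _; exact: measurable_funP. Qed.

Lemma measurable_weight k : measurable_fun [set: Omega] (weight k).
Proof. exact/measurable_clip_factor/measurable_df_comp/measurable_iterate. Qed.

Lemma weight_ge0 k w : 0 <= weight k w.
Proof. exact: clip_factor_ge0. Qed.

Lemma weight_le1 k w : weight k w <= 1.
Proof. exact: clip_factor_le1. Qed.

Lemma iterateS k w : iterate k.+1 w =
  iterate k w - (eta * clip_factor c (batch_grad k w)) *: batch_grad k w.
Proof. by []. Qed.

Lemma step_le k w : enorm (iterate k.+1 w - iterate k w) <= eta * c.
Proof.
rewrite iterateS [_ - _ - _]addrAC subrr sub0r enormN enormZ ger0_norm; last first.
  by rewrite mulr_ge0 ?clip_factor_ge0// ltW.
by rewrite -mulrA ler_pM2l// clipped_norm_le.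
Qed.

Lemma iterate_dist_le k w : enorm (iterate k w - x0) <= k%:R * (eta * c).
Proof.
elim: k => [|k IH]; first by rewrite subrr enorm0 mul0r.
rewrite -[X in X - _](subrK (iterate k w)) -addrA (le_trans (enorm_triangle _ _))//.
by rewrite -natr1 mulrDl mul1r [leRHS]addrC lerD// step_le.
Qed.

(** ** Bounds along the trajectory *)

(** The first [k] iterates lie in a fixed ball on every realization, not only
    almost surely; by compactness the gap and the exact gradient are bounded
    along them, hence integrable. *)
Lemma objective_bounded r : exists2 M, 0 <= M &
  forall x, enorm (x - x0) <= r -> f x - f xstar <= M.
Proof.
pose A := [set v : 'rV[R]_d | forall i, `[x0 0 i - r, x0 0 i + r]%classic (v 0 i)].
have cA : compact A.
  apply: (@rV_compact _ _ (fun i => `[x0 0 i - r, x0 0 i + r]%classic)) => i.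
  exact: segment_compact.
have xA x : enorm (x - x0) <= r -> A x.
  move=> xr i; have := le_trans (coord_le_enorm (x - x0) i) xr.
  by rewrite !mxE ler_norml /= in_itv/= => /andP[]; lra.
have [r0|r0] := leP 0 r; last first.
  by exists 0 => // x /le_lt_trans/(_ r0); rewrite ltNge enorm_ge0.
have A0 : A !=set0 by exists x0; apply: xA; rewrite subrr enorm0.
have cf : {within A, continuous f}.
  by apply: continuous_subspaceT => x; exact/differentiable_continuous/f_differentiable.
have [m _ mM] := EVT_max_rV A0 cA cf.
exists (f m - f xstar); first by rewrite subr_ge0.
by move=> x /xA Ax; rewrite lerD2r; apply: mM; rewrite inE.
Qed.

Let f_convex := objective_convex F_integrable F_unbiased F_smooth.

(** By convexity a gradient of norm [G] raises the objective by at least [G] at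
    distance one. *)
Lemma df_bounded r : exists2 M, 0 <= M &
  forall x, enorm (x - x0) <= r -> enorm (df x) <= M.
Proof.
have [M M0 HM] := objective_bounded (r + 1).
exists M => // x xr; have [u u1 uG] := unit_direction (df x).
have := f_convex x (x + u); rewrite addrAC subrr add0r uG.
have := xstar_min x.
have : f (x + u) - f xstar <= M.
  apply: HM; rewrite addrAC (le_trans (enorm_triangle _ _))//.
  by rewrite lerD.
by lra.
Qed.

Lemma integrable_gap k : integrable_fun P (fun w => f (iterate k w) - f xstar).
Proof.
have [M M0 HM] := objective_bounded (k%:R * (eta * c)).
apply: (@bounded_integrable_fun _ _ _ _ _ M).
  apply: measurable_funB => //.
  exact/measurable_objective_comp/measurable_iterate.
by move=> w; rewrite ger0_norm ?subr_ge0// HM// iterate_dist_le.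
Qed.

Lemma integrable_objective_iterate k : integrable_fun P (fun w => f (iterate k w)).
Proof.
have := integrable_funD (integrable_gap k) (integrable_fun_cst P (f xstar)).
by under eq_fun do rewrite subrK.
Qed.

Lemma measurable_enorm_df k : measurable_fun [set: Omega] (fun w => enorm (df (iterate k w))).
Proof. exact/measurable_enorm/measurable_df_comp/measurable_iterate. Qed.

Lemma integrable_enorm_df k : integrable_fun P (fun w => enorm (df (iterate k w))).
Proof.
have [M M0 HM] := df_bounded (k%:R * (eta * c)).
apply: (@bounded_integrable_fun _ _ _ _ _ M); first exact: measurable_enorm_df.
by move=> w; rewrite ger0_norm ?enorm_ge0// HM// iterate_dist_le.
Qed.

Lemma integrable_weighted_df2 k :
  integrable_fun P (fun w => weight k w * enorm (df (iterate k w)) ^+ 2).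
Proof.
have [M M0 HM] := df_bounded (k%:R * (eta * c)).
apply: (@bounded_integrable_fun _ _ _ _ _ (M ^+ 2)).
  apply: measurable_funM; first exact: measurable_weight.
  exact/measurable_funX/measurable_enorm_df.
move=> w; rewrite ger0_norm; last by rewrite mulr_ge0 ?weight_ge0 ?sqr_ge0.
apply: (@le_trans _ _ (enorm (df (iterate k w)) ^+ 2)).
  by rewrite ler_piMl ?weight_le1 ?sqr_ge0.
by rewrite ler_pXn2r ?nnegrE ?enorm_ge0// HM// iterate_dist_le.
Qed.

(** ** Distance to the minimizer *)

Lemma sample_ae (Q : X -> Prop) : {ae D, forall s, Q s} ->
  {ae P, forall w, forall k i, Q (xi k i w)}.
Proof.
move=> [N [mN N0 QN]]; apply: ae_foralln => k; apply: filter_forall => i.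
exists (xi k i @^-1` N); split.
- by rewrite -[X in measurable X]setTI; exact: measurable_funP.
- by have [/(_ k i N mN) + _] := xi_iid; rewrite /distribution /pushforward /= => ->.
- by move=> w /= nQ; exact: QN.
Qed.

(** Almost surely every sample met by the algorithm is convex, smooth and
    stationary at [xstar], so each step is nonexpansive. *)
Lemma iterate_dist_min_ae :
  {ae P, forall w, forall k, enorm (iterate k w - xstar) <= enorm (x0 - xstar)}.
Proof.
have min0 := sg_min_ae0 F_integrable F_differentiable F_unbiased rho_ge1
  F_strong_growth L0_ge0 L1_ge0 F_smooth xstar_min.
have both : {ae D, forall s, L0L1_smooth_convex L0 L1 (F ^~ s) /\ sg xstar s = 0}.
  exact: filterI.
apply: filterS (sample_ae both) => w good k; elim: k => [//|k IH].
apply: le_trans IH; rewrite iterateS.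
apply: (@clipped_step_nonexpansive _ _ L0 L1 c eta B
  (fun i => F ^~ (xi k i w)) _ _ (fun i => sg (iterate k w) (xi k i w))) => //.
- move=> i; have [smooth _] := good k i.
  by have [] := smooth (iterate k w) xstar xstar; rewrite ?subrr ?enorm0 ?mulr0 ?ler01.
- move=> i y; have [smooth z0] := good k i.
  have [] := smooth xstar y y; rewrite ?subrr ?enorm0 ?mulr0 ?ler01//.
  by rewrite -/(sg xstar (xi k i w)) z0 dotp0l addr0.
- move=> i y yx; have [smooth _] := good k i.
  by have [] := smooth y y (iterate k w) yx.
Qed.

Lemma gap_le_ae k : {ae P, forall w,
  f (iterate k w) - f xstar <= enorm (x0 - xstar) * enorm (df (iterate k w))}.
Proof.
apply: filterS iterate_dist_min_ae => w /(_ k) dist.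
have := f_convex (iterate k w) xstar.
have := cauchy_schwarz (df (iterate k w)) (iterate k w - xstar).
rewrite -[in X in _ -> X -> _](opprB (iterate k w)) dotpNr.
have := ler_wpM2r (enorm_ge0 (df (iterate k w))) dist.
by lra.
Qed.

(** ** Variance of the batch *)

Local Notation Y := (fun p : nat * 'I_B => xi p.1 p.2).

Definition sample_error k i w := err (iterate k w) (xi k i w).

Section SampleOff.
Variables (k : nat) (i : 'I_B).
Local Notation T := (sigma_off Y (k, i)).

Lemma measurable_iterate_off : measurable_coords (iterate k : T -> 'rV[R]_d).
Proof.
apply: measurable_clipSGD => // l j lk.
apply: (@measurable_sigma_off _ _ _ _ _ _ _ Y (k, i) (l, j)).
by rewrite xpair_eqE (ltn_eqF lk).
Qed.

Let measurable_iterate_fst :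
  measurable_coords (fun z : T * X => iterate k z.1).
Proof. by move=> a; exact: (measurableT_comp (measurable_iterate_off a)). Qed.

Let measurable_error_off :
  measurable_coords (fun z : T * X => err (iterate k z.1) z.2).
Proof.
apply: measurable_coordsB; last exact: measurable_df_comp.
exact: (@measurable_grad _ _ _ _ _ _ F mF snd).
Qed.

Let measurable_weight_off : measurable_fun [set: T] (weight k).
Proof. exact: measurable_clip_factor c_gt0 (measurable_df_comp measurable_iterate_off). Qed.

Let measurable_weight_fst : measurable_fun [set: T * X] (fun z => weight k z.1).
Proof. exact: (measurableT_comp measurable_weight_off). Qed.

Let sample_law S : measurable S -> P (Y (k, i) @^-1` S) = D S.
Proof. by move=> mS; have [/(_ k i S mS)] := xi_iid. Qed.

Lemma weighted_error2_le :
  (\int[P]_w (weight k w * enorm (sample_error k i w) ^+ 2)%:E <=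
   ((rho - 1) * \int[P]_w (weight k w * enorm (df (iterate k w)) ^+ 2))%:E)%E.
Proof.
rewrite -meanZ; last exact: integrable_weighted_df2.
rewrite -EFin_mean; last exact/integrable_funZ/integrable_weighted_df2.
have [_ indep] := xi_iid.
apply: (@freezing_off_le _ _ _ _ _ P D _ Y indep (k, i) sample_law
  (fun z => (weight k z.1 * enorm (err (iterate k z.1) z.2) ^+ 2)%:E)
  (fun w => ((rho - 1) * (weight k w * enorm (df (iterate k w)) ^+ 2))%:E)).
- apply/measurable_EFinP/measurable_funM => //.
  exact: measurable_enorm2.
- by move=> z; rewrite lee_fin mulr_ge0 ?weight_ge0 ?sqr_ge0.
- apply/measurable_EFinP; apply: measurable_funM => //.
  apply: measurable_funM => //; apply: measurable_enorm2.
  exact: measurable_df_comp measurable_iterate_off.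
- move=> w /=.
  have ie := integrable_error2 F_integrable F_differentiable F_unbiased F_strong_growth
    (iterate k w).
  rewrite EFin_mean; last exact: (integrable_funZ (weight k w) ie).
  rewrite lee_fin meanZ// [leRHS]mulrCA ler_wpM2l ?weight_ge0//.
  exact: mean_error2_le.
Qed.

Lemma measurable_sample_error : measurable_coords (sample_error k i).
Proof.
apply: measurable_coordsB; last exact/measurable_df_comp/measurable_iterate.
by apply: (@measurable_grad _ _ _ _ _ _ F mF (xi k i)) => //; exact: measurable_iterate.
Qed.

Lemma integrable_weighted_error2 :
  integrable_fun P (fun w => weight k w * enorm (sample_error k i w) ^+ 2).
Proof.
apply: ge0_integrable_fun weighted_error2_le.
- apply: measurable_funM; first exact: measurable_weight.
  exact/measurable_enorm2/measurable_sample_error.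
- by move=> w; rewrite mulr_ge0 ?weight_ge0 ?sqr_ge0.
Qed.

End SampleOff.

Lemma integrable_cross_error k i j : integrable_fun P
  (fun w => weight k w * dotp (sample_error k i w) (sample_error k j w)).
Proof.
apply: le_integrable_fun (integrable_funD (integrable_weighted_error2 k i)
  (integrable_weighted_error2 k j)).
  apply: measurable_funM; first exact: measurable_weight.
  by apply: measurable_dotp; exact: measurable_sample_error.
move=> w; rewrite normrM (ger0_norm (weight_ge0 _ _)) -mulrDr ler_wpM2l ?weight_ge0//.
rewrite (le_trans (normr_dotp_le _ _))//.
move: (enorm (sample_error k i w)) (enorm (sample_error k j w)) => a b.
by have := sqr_ge0 (a - b); have := sqr_ge0 a; have := sqr_ge0 b; lra.
Qed.

(** Two distinct samples of a batch: given the past and the first one, the error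
    of the second has mean zero. *)
Lemma mean_cross_error k i j : j != i ->
  \int[P]_w (weight k w * dotp (sample_error k j w) (sample_error k i w)) = 0.
Proof.
move=> ji; have [law indep] := xi_iid.
pose T := sigma_off Y (k, i).
have mit : measurable_coords (iterate k : T -> 'rV[R]_d) := @measurable_iterate_off k i.
have mxj : measurable_fun [set: T] (xi k j).
  apply: (@measurable_sigma_off _ _ _ _ _ _ _ Y (k, i) (k, j)).
  by rewrite xpair_eqE negb_and ji orbT.
have mej : measurable_coords (sample_error k j : T -> 'rV[R]_d).
  apply: measurable_coordsB; last exact: measurable_df_comp.
  exact: (@measurable_grad _ _ _ T _ _ F mF (xi k j)).
have mfst (V : T -> 'rV[R]_d) : measurable_coords V ->
    measurable_coords (fun z : T * X => V z.1).
  by move=> mV a; exact: (measurableT_comp (mV a)).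
rewrite /Rintegral.
rewrite (@freezing_off_mean0 _ _ _ _ _ P D _ Y indep (k, i) (fun S => law k i S)
  (fun z => (weight k z.1 * dotp (sample_error k j z.1) (err (iterate k z.1) z.2))%:E))//.
- apply/measurable_EFinP; apply: measurable_funM.
    have mw : measurable_fun [set: T] (weight k).
      exact: measurable_clip_factor c_gt0 (measurable_df_comp mit).
    exact: (measurableT_comp mw).
  have mz := mfst _ mit.
  apply: measurable_dotp; first exact: (mfst _ mej).
  apply: measurable_coordsB; last exact: measurable_df_comp mz.
  exact: (@measurable_grad _ _ _ _ _ _ F mF snd).
- exact: integrable_cross_error.
- move=> w /=.
  have ie := integrable_dotp_error F_unbiased (iterate k w) (sample_error k j w).
  rewrite EFin_mean; last exact: (integrable_funZ (weight k w) ie).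
  by rewrite meanZ// mean_dotp_error// mulr0.
Qed.

Lemma batch_errorE k w : batch_grad k w - df (iterate k w) =
  B%:R^-1 *: \sum_(i < B) sample_error k i w.
Proof.
rewrite /batch_grad /minibatch_grad /sample_error /sg_error sumrB scalerBr.
by rewrite sumr_const card_ord -(scaler_nat B (df _)) scalerA mulVf ?scale1r// pnatr_eq0 -lt0n.
Qed.

Lemma batch_error2E k w :
  weight k w * enorm (batch_grad k w - df (iterate k w)) ^+ 2 =
  B%:R^-1 ^+ 2 * \sum_(j < B) \sum_(i < B)
    (weight k w * dotp (sample_error k j w) (sample_error k i w)).
Proof.
rewrite batch_errorE enormZ exprMn real_normK ?num_real// enormE mulrCA.
congr (_ * _); rewrite dotp_suml mulr_sumr; apply: eq_bigr => j _.
by rewrite dotp_sumr mulr_sumr.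
Qed.

Lemma integrable_batch_error2 k : integrable_fun P
  (fun w => weight k w * enorm (batch_grad k w - df (iterate k w)) ^+ 2).
Proof.
under eq_fun do rewrite batch_error2E.
apply: integrable_funZ; apply: integrable_fun_sum => j; apply: integrable_fun_sum => i.
exact: integrable_cross_error.
Qed.

(** The cross terms vanish in mean, so averaging [B] samples divides the variance
    of one of them, at most [rho - 1] times [|df| ^ 2], by [B]. *)
Lemma mean_batch_error2_le k :
  36 * \int[P]_w (weight k w * enorm (batch_grad k w - df (iterate k w)) ^+ 2)
  <= \int[P]_w (weight k w * enorm (df (iterate k w)) ^+ 2).
Proof.
set A := (X in _ <= X).
have A0 : 0 <= A.
  by apply: Rintegral_ge0 => w _; rewrite mulr_ge0 ?weight_ge0 ?sqr_ge0.
have icross := integrable_cross_error k.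
under eq_Rintegral do rewrite batch_error2E.
rewrite meanZ; last first.
  by apply: integrable_fun_sum => j; apply: integrable_fun_sum => i.
rewrite mean_sum; last by move=> j; apply: integrable_fun_sum => i.
have diag j : \int[P]_w (\sum_(i < B)
    (weight k w * dotp (sample_error k j w) (sample_error k i w))) <= (rho - 1) * A.
  rewrite mean_sum// (bigD1 j)//= big1 ?addr0; last first.
    by move=> i ij; rewrite mean_cross_error// eq_sym.
  under eq_Rintegral do rewrite -enormE.
  rewrite -lee_fin -EFin_mean; last exact: integrable_weighted_error2.
  exact: weighted_error2_le.
have B0 : 0 < B%:R :> R by rewrite ltr0n.
have : B%:R^-1 ^+ 2 * \sum_(j < B) \int[P]_w (\sum_(i < B)
    (weight k w * dotp (sample_error k j w) (sample_error k i w)))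
  <= B%:R^-1 ^+ 2 * (B%:R * ((rho - 1) * A)).
  rewrite ler_wpM2l ?sqr_ge0//.
  apply: le_trans (ler_sum _ (fun j _ => diag j)) _.
  by rewrite sumr_const card_ord mulr_natl.
rewrite (_ : _ * (B%:R * _) = B%:R^-1 * ((rho - 1) * A)) => [up|]; last first.
  by rewrite expr2 -mulrA mulKf ?gt_eqF.
apply: (@le_trans _ _ (36 * (B%:R^-1 * ((rho - 1) * A)))); first by rewrite ler_pM2l.
rewrite (_ : 36 * _ = (36 * (rho - 1) / B%:R) * A); last by ring.
by rewrite ler_piMl// ler_pdivrMr// mul1r.
Qed.

(** ** Decrease in mean *)

Definition mean_gap k := \int[P]_w (f (iterate k w) - f xstar).

Let f_smooth := objective_smooth F_integrable F_differentiable F_unbiased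
  rho_ge1 F_strong_growth L1_ge0 F_smooth.

Lemma mean_gap_ge0 k : 0 <= mean_gap k.
Proof. by apply: Rintegral_ge0 => w _; rewrite subr_ge0. Qed.

Lemma iterate_descent k w :
  f (iterate k.+1 w) - f xstar <= (f (iterate k w) - f xstar) -
    eta * (1 / 2 * (weight k w * enorm (df (iterate k w)) ^+ 2) -
           7 * (weight k w * enorm (batch_grad k w - df (iterate k w)) ^+ 2)).
Proof.
have step : L1 * enorm (iterate k.+1 w - iterate k w) <= 1.
  apply: (@le_trans _ _ (L1 * (eta * c))); first by rewrite ler_wpM2l ?step_le.
  by move: step_L1; lra.
have L_0 : 0 <= Num.sqrt rho * L1 by rewrite mulr_ge0 ?sqrtr_ge0.
have := clipped_descent L0_ge0 L_0 c_gt0 eta_gt0 eta_small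
  (g := batch_grad k w) (f_smooth step).
by rewrite -/(iterate k.+1 w) -/(weight k w); lra.
Qed.

Lemma mean_gap_descent k :
  mean_gap k.+1 <= mean_gap k -
    eta * (11 / 36 * \int[P]_w (weight k w * enorm (df (iterate k w)) ^+ 2)).
Proof.
have ig := integrable_gap k; have ia := integrable_weighted_df2 k.
have ib := integrable_batch_error2 k.
have id := integrable_funB (integrable_funZ (1 / 2) ia) (integrable_funZ 7 ib).
have ie := integrable_funZ eta id.
have := le_mean (integrable_gap k.+1) (integrable_funB ig ie) (iterate_descent k).
rewrite -/(mean_gap k.+1) meanB// -/(mean_gap k) meanZ// meanB; last 2 first.
- exact: integrable_funZ.
- exact: integrable_funZ.
rewrite (meanZ (1 / 2))// (meanZ 7)// => /le_trans; apply.
(* The error term costs at most [7 / 36] of the gain [1 / 2]. *)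
by rewrite lerD2l lerN2 ler_pM2l//; have := mean_batch_error2_le k; lra.
Qed.

(** [weight * |df| ^ 2] is [min c |df| * |df|], which is not convex in [|df|];
    it has affine minorants of every slope [m <= c], and an affine bound passes
    to the mean. *)
Lemma mean_weighted_df2_ge k m : 0 <= m -> m <= c ->
  m * \int[P]_w enorm (df (iterate k w)) - m ^+ 2 / 4 <=
  \int[P]_w (weight k w * enorm (df (iterate k w)) ^+ 2).
Proof.
move=> m0 mc.
have iG := integrable_enorm_df k.
have ic := integrable_fun_cst P (m ^+ 2 / 4).
have iZ := integrable_funZ m iG.
rewrite -[X in _ - X <= _](mean_cst P) -meanZ// -meanB//.
apply: le_mean; [exact: integrable_funB|exact: integrable_weighted_df2|move=> w].
rewrite /weight; have G0 := enorm_ge0 (df (iterate k w)).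
have [[-> _]|[cG w0 w1 wG]] := clip_factorP (df (iterate k w)) c_gt0.
  by have := sqr_ge0 (enorm (df (iterate k w)) - m / 2); lra.
rewrite expr2 mulrA wG.
have := ler_wpM2r G0 mc; have := sqr_ge0 m; lra.
Qed.

Lemma mean_gap_le k :
  mean_gap k <= enorm (x0 - xstar) * \int[P]_w enorm (df (iterate k w)).
Proof.
have iG := integrable_enorm_df k.
rewrite -meanZ//; apply: le_mean_ae (gap_le_ae k).
- exact: integrable_gap.
- exact: integrable_funZ.
Qed.

(** The minorant is taken with slope [min c s], where [s = mean_gap k / R0] is a
    lower bound for the mean of [|df|]. *)
Lemma mean_gap_rec k : 0 < enorm (x0 - xstar) ->
  mean_gap k.+1 <= mean_gap k -
    eta / 9 * Num.min c (mean_gap k / enorm (x0 - xstar))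
            * (mean_gap k / enorm (x0 - xstar)).
Proof.
move=> R0; set s := mean_gap k / _; set m := Num.min c s.
have s0 : 0 <= s by rewrite divr_ge0 ?mean_gap_ge0// ltW.
have m0 : 0 <= m by rewrite le_min s0 ltW.
have mc : m <= c by rewrite ge_min lexx.
have ms : m <= s by rewrite ge_min lexx orbT.
have sG : s <= \int[P]_w enorm (df (iterate k w)).
  by rewrite ler_pdivrMr// mulrC mean_gap_le.
apply: le_trans (mean_gap_descent k) _.
rewrite lerD2l lerN2 -mulrA -mulrA ler_pM2l//.
(* As [m <= s], the minorant [m * s - m ^ 2 / 4] is at least [3 / 4 * m * s], and
   [11 / 36 * (3 / 4) >= 1 / 9]. *)
have := mean_weighted_df2_ge k m0 mc; have := ler_wpM2l m0 sG.
have := ler_wpM2l m0 ms; have := mulr_ge0 m0 s0.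
by rewrite expr2; lra.
Qed.

Lemma mean_gap_start : mean_gap 0%N = f x0 - f xstar.
Proof. exact: (mean_cst P (f x0 - f xstar)). Qed.

Lemma expected_gapE k :
  ('E_P[fun w => f (iterate k w)] - (f xstar)%:E)%E = (mean_gap k)%:E.
Proof.
have fi := integrable_objective_iterate k.
have ic := integrable_fun_cst P (f xstar).
by rewrite unlock EFin_mean// -EFinB /mean_gap meanB// mean_cst.
Qed.

End Trajectory.

Theorem theorem4p6 (R : realType) (d : nat)
    (dX : measure_display) (X : measurableType dX) (D : probability X R)
    (F : 'rV[R]_d -> X -> R)
    (F_integrable : forall x, D.-integrable [set: X] (fun s => (F x s)%:E))
    (F_differentiable : forall s x, differentiable (F ^~ s) x)
    (f_differentiable : forall x, differentiable (objective D F) x)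
    (xstar : 'rV[R]_d)
    (xstar_min : forall x, objective D F xstar <= objective D F x)
    (L0 L1 : R) (L0_ge0 : 0 <= L0) (L1_ge0 : 0 <= L1)
    (F_smooth : {ae D, forall s, L0L1_smooth_convex L0 L1 (F ^~ s)})
    (F_unbiased : unbiased D F)
    (rho : R) (rho_ge1 : 1 <= rho) (F_strong_growth : strong_growth D F rho)
    (B : nat) (B_ge1 : (1 <= B)%N) (B_large : 36 * (rho - 1) <= B%:R)
    (c : R) (c_gt0 : 0 < c)
    (eta : R) (eta_gt0 : 0 < eta)
    (eta_small : eta * (9 * (L0 + Num.sqrt rho * L1 * c)) <= 1)
    (dO : measure_display) (Omega : measurableType dO) (P : probability Omega R)
    (xi : nat -> 'I_B -> {RV P >-> X}) (xi_iid : iid_samples D xi)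
    (x0 : 'rV[R]_d) (N : nat) :
  let f := objective D F in
  let xN := fun w => clipSGD F eta c x0 (fun k i => xi k i w) N in
  let F0 := f x0 - f xstar in
  let R0 := enorm (x0 - xstar) in
  ('E_P[fun w => f (xN w)] - (f xstar)%:E
   <= (Num.max
         ((Num.max 0 (1 - eta * c / (36 * R0))) `^ (N%:R / 2) * F0)
         (18 * R0 ^+ 2 / (N%:R * eta)))%R%:E)%E.
Proof.
cbv zeta; set F0 := objective D F x0 - objective D F xstar; set R0 := enorm (x0 - xstar).
pose G := mean_gap D F xstar c eta xi x0.
rewrite (expected_gapE F_integrable F_differentiable f_differentiable xstar_min
  c_gt0 eta_gt0 xi x0) lee_fin -/(G N).
have G0 k : 0 <= G k by exact: mean_gap_ge0.
have GF : G 0%N = F0 by exact: mean_gap_start.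
(* For [R0 = 0] the scalar recursion divides by zero, but the gap, at most [R0]
   times the mean gradient norm, is already zero. *)
have [R00|R0n] := eqVneq R0 0.
  have := mean_gap_le F_integrable F_differentiable f_differentiable xstar_min
    L0_ge0 L1_ge0 F_smooth F_unbiased rho_ge1 F_strong_growth B_ge1 c_gt0 eta_gt0
    eta_small xi_iid x0 N.
  rewrite -/R0 R00 mul0r => GN.
  by rewrite le_max (le_trans GN)// mulr_ge0 ?powR_ge0// -GF.
have R0pos : 0 < R0 by rewrite lt_neqAle eq_sym R0n enorm_ge0.
rewrite -GF; apply: two_regime_rate => // k.
exact: (mean_gap_rec F_integrable F_differentiable f_differentiable xstar_min
  L0_ge0 L1_ge0 F_smooth F_unbiased rho_ge1 F_strong_growth B_ge1 B_large c_gt0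
  eta_gt0 eta_small xi_iid k R0pos).
Qed.
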